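(* Let $G_1,G_2$ be nontrivial finite groups, not both of order $2$, and let $G=G_1\star G_2$. Put $\Sigma_i=G_i\setminus\{1\}$ and $\Sigma=\Sigma_1\sqcup\Sigma_2$. For $p\in(0,1)$ let $\mu_p=p\,U_{\Sigma_1}+(1-p)\,U_{\Sigma_2}$, where $U_{\Sigma_i}$ is the uniform probability distribution on $\Sigma_i$. Let $h$ and $\gamma$ be the entropy and the drift (with respect to $\Sigma$) of the random walk $(G,\mu_p)$, and let $v$ be the volume of $G$ with respect to $\Sigma$. Then, for every $p\in(0,1)$, $$\frac{h}{\gamma v}=1 .$$
   Context: Random walk $(G,\mu)$: $X_0=1$, $X_{n+1}=X_nx_n$ with $(x_n)$ i.i.d. of law $\mu$. Let $|g|$ be the word length of $g\in G$ with respect to $\Sigma$. The drift is $\gamma=\lim_n|X_n|/n$ (a.s.). The entropy is $h=\lim_n-\frac1n\sum_{g\in G}\mu^{*n}(g)\log\mu^{*n}(g)$, where $\mu^{*n}$ is the $n$-th convolution power. The volume is $v=\lim_n\frac1n\log\#\{g\in G:|g|\le n\}$. *)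

(* Defs.v *)
From HB Require Import structures.
From mathcomp Require Import all_boot all_order all_algebra all_fingroup.
From mathcomp Require Import finmap.
From mathcomp Require Import all_classical all_reals all_analysis.

Set Implicit Arguments.
Unset Strict Implicit.
Unset Printing Implicit Defensive.

Import Order.TTheory GRing.Theory Num.Theory.
Import numFieldNormedType.Exports.

Local Open Scope classical_set_scope.
Local Open Scope group_scope.

(* The free product of two groups, built on reduced words: sequences of
   nontrivial letters of [G1 + G2] in which consecutive letters come from
   different factors.  [free_prod_universal] below is the universal property. *)
Section FreeProduct.
Variables G1 G2 : groupType.

Local Notation letter := (G1 + G2)%type.

Definition letter_is1 (l : letter) : bool :=
  match l with inl a => a == 1 | inr b => b == 1 end.

Definition letter_side (l : letter) : bool := if l is inl _ then true else false.

Definition letter_inv (l : letter) : letter :=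
  match l with inl a => inl a^-1 | inr b => inr b^-1 end.

Definition alternate (l m : letter) : bool := letter_side l != letter_side m.

Definition reduced (w : seq letter) : bool :=
  all (predC letter_is1) w && sorted alternate w.

Definition letter_cons (l : letter) (w : seq letter) : seq letter :=
  if letter_is1 l then w else l :: w.

(* The reduced form of [l :: w], for [w] reduced. *)
Definition letter_act (l : letter) (w : seq letter) : seq letter :=
  match l, w with
  | inl a, inl b :: w' => letter_cons (inl (a * b)) w'
  | inr a, inr b :: w' => letter_cons (inr (a * b)) w'
  | _, _ => letter_cons l w
  end.

Definition word_mul (u w : seq letter) : seq letter := foldr letter_act w u.

Definition word_inv (u : seq letter) : seq letter := rev (map letter_inv u).

Lemma reduced_cons l w :
  reduced (l :: w) = [&& ~~ letter_is1 l, path alternate l w & reduced w].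
Proof.
rewrite /reduced /=; case: (letter_is1 l) => //=.
by case: w => //= m w; case: (alternate l m) => /=; rewrite ?andbF //;
  case: (path _ _ _); rewrite ?andbF ?andbT.
Qed.

Lemma reduced_behead l w : reduced (l :: w) -> reduced w.
Proof. by rewrite reduced_cons => /and3P[]. Qed.

Lemma letter_act_cons l w : reduced (l :: w) -> letter_act l w = l :: w.
Proof.
rewrite reduced_cons => /and3P[l1 lw _].
by case: l w l1 lw => [a|a] [|[b|b] w] //= a1 _;
  rewrite /letter_cons /= (negbTE a1).
Qed.

Lemma letter_act_is1 l w : letter_is1 l -> reduced w -> letter_act l w = w.
Proof.
case: l w => [a|a] [|[b|b] w] //= /eqP-> //=; rewrite /letter_cons /= ?eqxx //;
by rewrite reduced_cons => /and3P[/negbTE /= b1 _ _]; rewrite mul1g b1.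
Qed.

Lemma letter_cons_reduced l m w : letter_side l = letter_side m ->
  reduced (m :: w) -> reduced (letter_cons l w).
Proof.
move=> lm; rewrite reduced_cons => /and3P[_ mw rw]; rewrite /letter_cons.
case: ifPn => // l1; rewrite reduced_cons l1 rw andbT /=.
by case: w mw {rw} => //= k w /andP[]; rewrite /alternate -lm => -> ->.
Qed.

Lemma letter_act_reduced l w : reduced w -> reduced (letter_act l w).
Proof.
have consP k v : path alternate k v -> reduced v -> reduced (letter_cons k v).
  by move=> kv rv; rewrite /letter_cons; case: ifPn => // k1;
    rewrite reduced_cons k1 kv.
have headP k m v : alternate k m -> reduced (m :: v) ->
    path alternate k (m :: v).
  by rewrite reduced_cons /= => -> /and3P[].
case: l w => [a|a] [|[b|b] w] rw; rewrite /letter_act.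
- exact: consP.
- exact: letter_cons_reduced rw.
- by apply: consP => //; apply: headP.
- exact: consP.
- by apply: consP => //; apply: headP.
- exact: letter_cons_reduced rw.
Qed.

Lemma letter_actMl a b w : reduced w ->
  letter_act (inl a) (letter_act (inl b) w) = letter_act (inl (a * b)) w.
Proof.
case: w => [|[c|c] w] rw /=; rewrite /letter_cons /=.
- by case: (eqVneq b 1) => [->|b1] //=; rewrite mulg1.
- case: (eqVneq (b * c) 1) => [bc1|bc1] /=; last by rewrite /letter_cons /= mulgA.
  rewrite -mulgA bc1 mulg1.
  by case: w rw => [|[d|d] w] //=; rewrite reduced_cons => /and3P[].
- by case: (eqVneq b 1) => [->|b1] //=; rewrite mulg1.
Qed.

Lemma letter_actMr a b w : reduced w ->
  letter_act (inr a) (letter_act (inr b) w) = letter_act (inr (a * b)) w.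
Proof.
case: w => [|[c|c] w] rw /=; rewrite /letter_cons /=.
- by case: (eqVneq b 1) => [->|b1] //=; rewrite mulg1.
- by case: (eqVneq b 1) => [->|b1] //=; rewrite mulg1.
- case: (eqVneq (b * c) 1) => [bc1|bc1] /=; last by rewrite /letter_cons /= mulgA.
  rewrite -mulgA bc1 mulg1.
  by case: w rw => [|[d|d] w] //=; rewrite reduced_cons => /and3P[].
Qed.

Lemma letter_actK l w : reduced w ->
  letter_act (letter_inv l) (letter_act l w) = w.
Proof.
by case: l => a rw; rewrite /letter_inv ?letter_actMl ?letter_actMr // mulVg
  letter_act_is1 //= eqxx.
Qed.

Lemma word_mul_reduced u w : reduced w -> reduced (word_mul u w).
Proof. by move=> rw; elim: u => //= l u; exact: letter_act_reduced. Qed.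

Lemma word_mul_nil u : reduced u -> word_mul u [::] = u.
Proof.
by elim: u => //= l u IHu rlu; rewrite IHu ?letter_act_cons // (reduced_behead rlu).
Qed.

Lemma word_mul_act l u w : reduced u -> reduced w ->
  word_mul (letter_act l u) w = letter_act l (word_mul u w).
Proof.
move=> ru rw; have rc v : reduced (word_mul v w) by exact: word_mul_reduced.
have consE k v : word_mul (letter_cons k v) w = letter_act k (word_mul v w).
  by rewrite /letter_cons; case: ifP => //= k1; rewrite letter_act_is1.
by case: l u ru => [a|a] [|[b|b] u] ru; rewrite [X in word_mul X w]/letter_act
  consE -?letter_actMl -?letter_actMr.
Qed.

Lemma word_mulA u v w : reduced v -> reduced w ->
  word_mul u (word_mul v w) = word_mul (word_mul u v) w.
Proof.
move=> rv rw; elim: u => //= l u ->.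
by rewrite word_mul_act // word_mul_reduced.
Qed.

Lemma word_invK : involutive word_inv.
Proof.
move=> u; rewrite /word_inv map_rev revK -map_comp -[RHS]map_id.
by apply: eq_map => -[a|a] /=; rewrite invgK.
Qed.

Lemma word_inv_reduced u : reduced u -> reduced (word_inv u).
Proof.
rewrite /reduced /word_inv all_rev all_map rev_sorted sorted_map => /andP[u1 su].
apply/andP; split.
  by apply: sub_all u1 => -[a|a] /=; rewrite invg_eq1.
by apply: sub_sorted su => -[a|a] [b|b].
Qed.

Lemma word_mulVw u w : reduced w -> word_mul (word_inv u) (word_mul u w) = w.
Proof.
move=> rw; elim: u => //= l u IHu.
rewrite /word_inv /= rev_cons /word_mul -cats1 foldr_cat /= letter_actK //.
exact: word_mul_reduced.
Qed.

Record free_prod := FreeProd {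
  fp_word :> seq letter;
  fp_reduced : reduced fp_word }.

HB.instance Definition _ := [isSub for fp_word].
HB.instance Definition _ := [Choice of free_prod by <:].

Definition fp_one : free_prod := @FreeProd [::] isT.

Definition fp_mul (x y : free_prod) : free_prod :=
  FreeProd (word_mul_reduced x (fp_reduced y)).

Definition fp_inv (x : free_prod) : free_prod :=
  FreeProd (word_inv_reduced (fp_reduced x)).

Lemma fp_mulA : associative fp_mul.
Proof. by move=> x y z; apply/val_inj; rewrite /= word_mulA ?fp_reduced. Qed.

Lemma fp_mul1 : left_id fp_one fp_mul.
Proof. by move=> x; apply/val_inj. Qed.

Lemma fp_mulx1 : right_id fp_one fp_mul.
Proof. by move=> x; apply/val_inj; rewrite /= word_mul_nil ?fp_reduced. Qed.

Lemma fp_mulV : left_inverse fp_one fp_inv fp_mul.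
Proof.
move=> x; apply/val_inj => /=.
by rewrite -[X in word_mul _ X]word_mul_nil ?fp_reduced // word_mulVw.
Qed.

Lemma fp_mulxV : right_inverse fp_one fp_inv fp_mul.
Proof.
move=> x; apply/val_inj => /=.
rewrite -[X in word_mul X _]word_invK -[X in word_mul _ X]word_mul_nil.
  by rewrite word_mulVw.
exact/word_inv_reduced/fp_reduced.
Qed.

HB.instance Definition _ := isGroup.Build free_prod
  fp_mulA fp_mul1 fp_mulx1 fp_mulV fp_mulxV.

Lemma letter_cons_nil_reduced (l : letter) : reduced (letter_cons l [::]).
Proof. by rewrite /letter_cons; case: ifPn => // l1; rewrite reduced_cons l1. Qed.

Definition fp_inl (a : G1) : free_prod :=
  FreeProd (letter_cons_nil_reduced (inl a)).

Definition fp_inr (b : G2) : free_prod :=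
  FreeProd (letter_cons_nil_reduced (inr b)).

Lemma fp_inlM : {morph fp_inl : a b / a * b}.
Proof.
move=> a b; apply/val_inj; rewrite /= /letter_cons /= /word_mul.
have [->|a1] := eqVneq a 1; first by rewrite mul1g.
by rewrite -[X in foldr _ X _]/(if b == 1 then [::] else [:: inl b]) /=;
  have [->|b1] := eqVneq b 1; rewrite ?mulg1 /= /letter_cons /= ?(negbTE a1).
Qed.

Lemma fp_inrM : {morph fp_inr : a b / a * b}.
Proof.
move=> a b; apply/val_inj; rewrite /= /letter_cons /= /word_mul.
have [->|a1] := eqVneq a 1; first by rewrite mul1g.
by rewrite -[X in foldr _ X _]/(if b == 1 then [::] else [:: inr b]) /=;
  have [->|b1] := eqVneq b 1; rewrite ?mulg1 /= /letter_cons /= ?(negbTE a1).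
Qed.

Theorem free_prod_universal (H : groupType) (f1 : G1 -> H) (f2 : G2 -> H) :
  {morph f1 : a b / a * b} -> {morph f2 : a b / a * b} ->
  exists! f : free_prod -> H,
    [/\ {morph f : x y / x * y}, f \o fp_inl = f1 & f \o fp_inr = f2].
Proof.
move=> f1M f2M.
have f11 : f1 1 = 1 by apply: (mulgI (f1 1)); rewrite -f1M !mulg1.
have f21 : f2 1 = 1 by apply: (mulgI (f2 1)); rewrite -f2M !mulg1.
pose ev (l : letter) := match l with inl a => f1 a | inr b => f2 b end.
pose evw (w : seq letter) := \prod_(l <- w) ev l.
have ev_cons l w : evw (letter_cons l w) = ev l * evw w.
  rewrite /letter_cons; case: ifP => [|_]; last by rewrite /evw big_cons.
  by case: l => a /= /eqP->; rewrite ?f11 ?f21 mul1g.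
have ev_act l w : evw (letter_act l w) = ev l * evw w.
  case: l w => [a|a] [|[b|b] w]; rewrite /letter_act ev_cons //=.
    by rewrite f1M /evw big_cons mulgA.
  by rewrite f2M /evw big_cons mulgA.
exists (fun x : free_prod => evw x); split.
  split.
  - move=> x y; rewrite -[LHS]/(evw (word_mul x y)).
    elim: (fp_word x) => [|l u IHu] /=; first by rewrite /evw big_nil mul1g.
    by rewrite ev_act IHu [evw (l :: u)]big_cons mulgA.
  - by apply/funext => a /=; rewrite ev_cons /evw big_nil mulg1.
  - by apply/funext => a /=; rewrite ev_cons /evw big_nil mulg1.
move=> f [fM f1E f2E]; apply/funext => -[w rw] /=.
have fp1 : f 1 = 1 by apply: (mulgI (f 1)); rewrite -fM !mulg1.
elim: w rw => [|l w IHw] rw.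
  by rewrite /evw big_nil -fp1; congr f; apply/val_inj.
have rw' := reduced_behead rw.
rewrite [LHS]big_cons -/(evw w) (IHw rw').
have l1 : ~~ letter_is1 l by move: rw; rewrite reduced_cons => /and3P[].
have -> : ev l = f (FreeProd (letter_cons_nil_reduced l)).
  by case: (l) => a /=; rewrite -?f1E -?f2E.
rewrite -fM; congr f; apply/val_inj => /=.
by rewrite /letter_cons (negbTE l1) /= letter_act_cons.
Qed.

End FreeProduct.

Local Open Scope ring_scope.

Section RandomWalks.
Variable R : realType.

(* [0] when [A] is infinite. *)
Definition unif (T : choiceType) (A : set T) (x : T) : R :=
  \1_A x / #|` fset_set A|%:R.

Section Group.
Variable G : groupType.

Definition word_of_size (S : set G) (g : G) : set nat :=
  [set n | exists s : seq G,
    [/\ size s = n, (forall x, x \in s -> S x) & (\prod_(x <- s) x)%g = g]].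

(* The least length of a product of elements of [S] equal to [g]; no inverses
   are taken, so [S] is meant to be symmetric.  Junk value [0] if there is no
   such product. *)
Definition word_length (S : set G) (g : G) : nat :=
  xget 0%N [set n | word_of_size S g n /\
                    forall m, word_of_size S g m -> (n <= m)%N].

(* Sums over [G] have finite support as soon as [mu] does; for an infinite
   support the library sum is [0]. *)
Definition convolution (mu nu : G -> R) (g : G) : R :=
  \sum_(k \in [set: G]) mu k * nu (k^-1 * g)%g.

Definition convolution_pow (mu : G -> R) (n : nat) : G -> R :=
  iter n (fun nu => convolution nu mu) (fun g => (g == 1%g)%:R).

(* Elements outside the support contribute [0 * ln 0 = 0]. *)
Definition is_entropy (mu : G -> R) (h : R) : Prop :=
  - (n%:R^-1 * \sum_(g \in [set: G])
       convolution_pow mu n g * ln (convolution_pow mu n g))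
    @[n --> \oo] --> h.

Definition is_volume (S : set G) (v : R) : Prop :=
  n%:R^-1 * ln #|` fset_set [set g | (word_length S g <= n)%N]|%:R
    @[n --> \oo] --> v.

Fixpoint walk (Omega : Type) (x : nat -> Omega -> G) (n : nat) (w : Omega) : G :=
  if n is m.+1 then (walk x m w * x m w)%g else 1%g.

(* [G] carries the discrete sigma-algebra; the law of the steps is given by its
   mass function [mu], which suffices when [G] is countable. *)
Definition iid_of_law d (Omega : measurableType d) (P : probability Omega R)
    (x : nat -> Omega -> G) (mu : G -> R) : Prop :=
  [/\ forall n (A : set G), measurable (x n @^-1` A),
      forall n g, P (x n @^-1` [set g]) = (mu g)%:E
    & forall (J : {fset nat}) (A : nat -> set G),
        P (\bigcap_(n in [set` J]) (x n @^-1` A n)) =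
        (\prod_(n <- J) P (x n @^-1` A n))%E].

Definition is_drift d (Omega : measurableType d) (P : probability Omega R)
    (S : set G) (x : nat -> Omega -> G) (gamma : R) : Prop :=
  {ae P, forall w,
    (word_length S (walk x n w))%:R / n%:R @[n --> \oo] --> gamma}.

End Group.

Section FreeProductWalk.
Variables G1 G2 : finGroupType.

Definition Sigma1 : set (free_prod G1 G2) :=
  [set fp_inl G2 a | a in [set a : G1 | a != 1%g]].

Definition Sigma2 : set (free_prod G1 G2) :=
  [set fp_inr G1 b | b in [set b : G2 | b != 1%g]].

Definition Sigma : set (free_prod G1 G2) := Sigma1 `|` Sigma2.

Definition mu_p (p : R) (g : free_prod G1 G2) : R :=
  p * unif Sigma1 g + (1 - p) * unif Sigma2 g.

End FreeProductWalk.
End RandomWalks.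

Arguments mu_p {R} G1 G2 p g.
Arguments Sigma1 G1 G2 _ : clear implicits.
Arguments Sigma2 G1 G2 _ : clear implicits.
Arguments Sigma G1 G2 _ : clear implicits.

(* Main.v *)
Require Import Defs.
From mathcomp Require Import all_boot all_order all_algebra all_fingroup.
From mathcomp Require Import finmap.
From mathcomp Require Import all_classical all_reals all_analysis.
From mathcomp Require Import ring lra.
Import Order.TTheory GRing.Theory Num.Theory.
Import numFieldNormedType.Exports.

Set Implicit Arguments.
Unset Strict Implicit.
Unset Printing Implicit Defensive.

Local Open Scope classical_set_scope.
Local Open Scope ring_scope.

(* The law of X_n at a reduced word depends only on its type, that is its length
   and the side of its first letter.  There are 2n+1 types of length at most n,
   so conditioning on the type costs O(log n) of entropy; given its type, X_n is
   uniform on about (ab)^(|X_n|/2) words, with a and b the numbers of nontrivial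
   letters of the two factors.  Hence h = lim E|X_n|/n * log(ab)/2, and
   v = log(ab)/2.
   For the drift, a function f of the type at bounded distance from the length
   satisfies E[f(X_(n+1)) | X_n] = f(X_n) + gamma everywhere, for an explicit
   gamma > 0.  So E|X_n| = gamma n + O(1), and since the martingale
   f(X_n) - gamma n has variance O(n), Chebyshev and Borel-Cantelli along the
   times k^4 give the almost sure convergence of |X_n|/n to gamma. *)

(** * Reduced words, their types, and right multiplication by a letter *)

Section Words.
Variables G1 G2 : finGroupType.
Local Notation letter := (G1 + G2)%type.
Local Notation G := (free_prod G1 G2).
Implicit Types (l c : letter) (g : G) (s i : bool) (k n : nat).

Definition elt (l : letter) : G := FreeProd (letter_cons_nil_reduced l).

Definition letter_mul (c l : letter) : letter :=
  match c, l with
  | inl a, inl b => inl (a * b)%g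
  | inr a, inr b => inr (a * b)%g
  | _, _ => l
  end.

Definition nontriv (s : bool) : pred letter :=
  [pred l | (letter_side l == s) && ~~ letter_is1 l].

Definition nb_letters (s : bool) : nat := if s then #|G1|.-1 else #|G2|.-1.

Definition head_side (w : seq letter) : bool :=
  if w is l :: _ then letter_side l else true.

(* Sides alternate in a reduced word, so that of the last letter is determined
   by the length and the side [i] of the first one; for length [0] this is the
   side that a letter preceding a word of head side [i] would have. *)
Definition last_side (i : bool) (k : nat) : bool := i (+) ~~ odd k.

Lemma last_sideS i k : last_side i k.+1 = ~~ last_side i k.
Proof. by rewrite /last_side /=; case: i; case: (odd k). Qed.

Lemma elt_nontriv l : ~~ letter_is1 l -> fp_word (elt l) = [:: l].
Proof. by rewrite /elt /= /letter_cons => /negbTE->. Qed.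

Lemma elt_is1 l : letter_is1 l -> elt l = 1%g.
Proof. by move=> l1; apply/val_inj; rewrite /= /letter_cons l1. Qed.

Lemma elt_inj : {in predC (@letter_is1 G1 G2) &, injective elt}.
Proof.
move=> k l; rewrite !inE => k1 l1 /(congr1 (@fp_word _ _)).
by rewrite !elt_nontriv // => -[].
Qed.

Lemma eltM c l : letter_side c = letter_side l ->
  (elt c * elt l)%g = elt (letter_mul c l).
Proof.
by case: c l => [a|a] [b|b] // _; rewrite -[elt _]/(fp_inl G2 _) ||
  rewrite -[elt _]/(fp_inr G1 _); rewrite -?fp_inlM -?fp_inrM.
Qed.

Lemma eltV l : (elt l)^-1%g = elt (letter_inv l).
Proof.
apply/val_inj => /=; rewrite /letter_cons.
have -> : letter_is1 (letter_inv l) = letter_is1 l by case: l => a; exact: invg_eq1.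
by case: (letter_is1 l).
Qed.

Lemma mul_elt g l : reduced (rcons g l) -> fp_word (g * elt l)%g = rcons g l.
Proof.
move=> r; have l1 : ~~ letter_is1 l.
  by move: r; rewrite /reduced all_rcons => /andP[/andP[]].
change (word_mul g (fp_word (elt l)) = rcons g l); rewrite elt_nontriv //.
rewrite -[RHS]word_mul_nil // /word_mul -cats1 foldr_cat /=.
by rewrite /letter_act /letter_cons (negbTE l1); case: (l).
Qed.

Lemma sorted_alternate_rcons (w : seq letter) l : sorted (@alternate G1 G2) (rcons w l) =
  sorted (@alternate G1 G2) w &&
    ((w == [::]) || (letter_side (last l w) != letter_side l)).
Proof. by case: w => //= a w; rewrite rcons_path. Qed.

Lemma last_head_side (w : seq letter) l : sorted (@alternate G1 G2) (rcons w l) ->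
  letter_side l = last_side (head_side (rcons w l)) (size w).+1.
Proof.
elim/last_ind: w l => [|w k IH] l; first by rewrite /= /last_side addbF.
rewrite sorted_alternate_rcons last_rcons => /andP[/IH] Hk.
have -> : head_side (rcons (rcons w k) l) = head_side (rcons w k) by case: w {Hk IH}.
rewrite size_rcons last_sideS -Hk.
by case: (rcons w k) (size_rcons w k) => //= _ _ _; case: letter_side; case: letter_side.
Qed.

(** Whether a letter can be appended to [g] depends only on the type of [g]; this is what makes the
    type of the walk a Markov chain. *)
Lemma reduced_rcons g l :
  reduced (rcons g l) = ~~ letter_is1 l &&
    ((size g == 0%N) || (letter_side l != last_side (head_side g) (size g))).
Proof.
have := fp_reduced g; rewrite /reduced all_rcons sorted_alternate_rcons.
move=> /andP[-> srt]; rewrite srt andbT /=; congr (_ && _).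
elim/last_ind: (fp_word g) srt => [|w k _] // srt.
rewrite last_rcons size_rcons -last_head_side // [letter_side k == _]eq_sym.
by case: w srt.
Qed.

(** The walk multiplies on the right, so words are decomposed by splitting off the last letter. *)
Lemma free_prodP g : g = 1%g \/ exists g' c,
  [/\ g = (g' * elt c)%g, fp_word g = rcons g' c & reduced (rcons g' c)].
Proof.
case: g => w; elim/last_ind: w => [|w c _] rw.
  by left; apply/val_inj.
right; have rw' : reduced w.
  move: (rw); rewrite /reduced all_rcons sorted_alternate_rcons.
  by move=> /andP[/andP[_ ->] /andP[-> _]].
exists (FreeProd rw'), c; split => //.
by apply/val_inj; rewrite [RHS]mul_elt.
Qed.

Lemma card_nontriv s : #|nontriv s| = nb_letters s.
Proof.
rewrite -sum1_card big_mkcond big_sumType /= /nb_letters; case: s => /=.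
  rewrite [X in (_ + X)%N]big1 ?addn0; last by [].
  by rewrite -(cardC1 (1%g : G1)) -sum1_card [RHS]big_mkcond;
    apply: eq_bigr => a _; rewrite inE.
rewrite [X in (X + _)%N]big1 ?add0n; last by [].
by rewrite -(cardC1 (1%g : G2)) -sum1_card [RHS]big_mkcond;
    apply: eq_bigr => a _; rewrite inE.
Qed.

Definition triv_letter s : letter := if s then inl 1%g else inr 1%g.

(** The trivial letter is included, so that the sum runs over a whole left coset of one of the two
    factors. *)
Definition coset_sum (V : nmodType) (F : G -> V) s g : V :=
  \sum_(l | letter_side l == s) F (g * elt l)%g.

Lemma coset_sumE (V : nmodType) (F : G -> V) s g :
  coset_sum F s g = F g + \sum_(l | nontriv s l) F (g * elt l)%g.
Proof.
rewrite /coset_sum (bigD1 (triv_letter s)) /=; last by case: s.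
rewrite elt_is1 ?mulg1; last by case: s; rewrite /= eqxx.
by congr (_ + _); apply: eq_bigl => -[a|a]; case: s.
Qed.

(** Left multiplication by [c] permutes its factor, so both elements lie in the same coset. *)
Lemma coset_sumM (V : nmodType) (F : G -> V) g c :
  coset_sum F (letter_side c) (g * elt c)%g = coset_sum F (letter_side c) g.
Proof.
pose h l := if letter_side l == letter_side c then letter_mul c l else l.
have inj_h : injective h.
  rewrite /h => -[a|a] [b|b]; case: (c) => [d|d] //= [] // /mulgI -> //.
rewrite /coset_sum [RHS](reindex_inj inj_h); apply: eq_big => l.
  by rewrite /h; case: c {h inj_h} => d; case: l => a.
by rewrite /h => /eqP lc; rewrite lc eqxx -mulgA eltM.
Qed.

Lemma size_letter_act l (w : seq letter) : (size (letter_act l w) <= (size w).+1)%N.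
Proof.
rewrite /letter_act /letter_cons; case: l => a; case: w => [|[b|b] w] //=;
  by case: ifP => //= _; do 2?apply: ltnW.
Qed.

Lemma size_mul_elt g l : (size (fp_word (g * elt l)%g) <= (size g).+1)%N.
Proof.
have sizeV (h : G) : size (fp_word h^-1%g) = size h.
  by rewrite /= /word_inv size_rev size_map.
have [l1|l1] := boolP (letter_is1 l); first by rewrite elt_is1 // mulg1.
(* Letters act on the left of words; passing to inverses, which have the same length, turns right
   multiplication into left multiplication. *)
rewrite -[X in size (fp_word X)]invgK sizeV invgM eltV -(sizeV g).
set h := g^-1%g; have l1' : ~~ letter_is1 (letter_inv l).
  by case: l l1 => a /=; rewrite invg_eq1.
rewrite -[fp_word _]/(word_mul (fp_word (elt (letter_inv l))) (fp_word h)).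
rewrite elt_nontriv //; exact: size_letter_act.
Qed.

Lemma size_mul_elt_ge g l : (size g <= (size (fp_word (g * elt l)%g)).+1)%N.
Proof. by have := size_mul_elt (g * elt l)%g (letter_inv l); rewrite -eltV mulgK. Qed.

End Words.

(** * Word length, spheres by type, and balls *)

Section Spheres.
Variables G1 G2 : finGroupType.
Local Notation letter := (G1 + G2)%type.
Local Notation G := (free_prod G1 G2).
Implicit Types (l c : letter) (g : G) (s i : bool) (k n : nat).

Lemma SigmaP g : Sigma G1 G2 g <-> exists2 l, ~~ letter_is1 l & g = elt l.
Proof.
split=> [[[a a1 <-]|[a a1 <-]]|[[a|a] a1 ->]].
- by exists (inl a).
- by exists (inr a).
- by left; exists a.
- by right; exists a.
Qed.

Lemma size_prod_Sigma (r : seq G) : (forall x, x \in r -> Sigma G1 G2 x) ->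
  (size (fp_word (\prod_(x <- r) x)%g) <= size r)%N.
Proof.
elim/last_ind: r => [|r x IH] rS; first by rewrite big_nil.
rewrite big_rcons /= size_rcons.
have /SigmaP[l _ ->] : Sigma G1 G2 x by apply: rS; rewrite mem_rcons mem_head.
rewrite (leq_trans (size_mul_elt _ _)) // ltnS IH // => y yr.
by apply: rS; rewrite mem_rcons inE yr orbT.
Qed.

Lemma word_of_size_size g : word_of_size (Sigma G1 G2) g (size g).
Proof.
have [n] := ubnP (size g); elim: n g => // n IH g gn.
have [->|[g' [c [gE wE]]]] := free_prodP g.
  by exists [::]; split; rewrite ?big_nil.
rewrite reduced_rcons => /andP[c1 _]; move: gn; rewrite wE size_rcons => gn.
have [//|r [sr rS pr]] := IH g'.
exists (rcons r (elt c)); split; first by rewrite size_rcons sr.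
  move=> x; rewrite mem_rcons inE => /predU1P[->|/rS //].
  by apply/SigmaP; exists c.
by rewrite big_rcons pr gE.
Qed.

Lemma word_length_Sigma g : word_length (Sigma G1 G2) g = size g.
Proof.
rewrite /word_length; case: xgetP => [n _ [[r [<- rS <-]] n_min]|/(_ (size g))[]].
  by apply/eqP; rewrite eqn_leq size_prod_Sigma // n_min //; exact: word_of_size_size.
split; first exact: word_of_size_size.
by move=> m [r [<- rS <-]]; exact: size_prod_Sigma.
Qed.

Fixpoint words k i : seq (seq letter) :=
  if k is k'.+1 then [seq l :: w | l <- enum (@nontriv G1 G2 i), w <- words k' (~~ i)]
  else [:: [::]].

Fixpoint nb_words k i : nat :=
  if k is k'.+1 then (nb_letters G1 G2 i * nb_words k' (~~ i))%N else 1%N.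

Lemma size_words k i : size (words k i) = nb_words k i.
Proof.
elim: k i => //= k IH i.
by rewrite (size_allpairs (fun l w => l :: w)) IH -cardE card_nontriv.
Qed.

Lemma uniq_words k i : uniq (words k i).
Proof.
elim: k i => //= k IH i.
apply: (allpairs_uniq (f := fun l w => l :: w)) => //; first exact: enum_uniq.
by move=> [l w] [l' w'] _ _ /= [-> ->].
Qed.

Lemma mem_words k i w : (w \in words k i) =
  [&& reduced w, size w == k & (k == 0%N) || (head_side w == i)].
Proof.
elim: k i w => [|k IH] i w.
  by rewrite inE andbT; case: w => [|l w] /=; rewrite ?andbF.
case: w => [|l w]; first by apply/negP => /allpairsP[[? ?] []].
rewrite reduced_cons /= eqSS.
apply/allpairsP/idP => [[[l' w'] [/= l'i w'k [-> ->]]]|].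
  move: l'i w'k; rewrite mem_enum /= inE IH => /andP[/eqP l'i ->] /and3P[rw sw H].
  rewrite l'i eqxx rw sw !andbT /=; case: w' sw H rw => // m w' /eqP<- /= /eqP mi.
  by rewrite reduced_cons /alternate mi l'i => /and3P[_ -> _]; case: (i).
move=> /andP[/and3P[l1 lw rw] /andP[sw /eqP li]]; exists (l, w); split=> //=.
  by rewrite mem_enum inE /= li eqxx.
rewrite IH rw sw /=; case: w lw sw {rw} => [|m w] /=; first by move=> _ /eqP<-.
move=> /andP[]; rewrite /alternate li => H _ _; apply/orP; right.
by move: H; case: letter_side; case: (i).
Qed.

Definition word_sphere k i : seq G := pmap insub (words k i).

Lemma map_word_sphere k i : map (@fp_word G1 G2) (word_sphere k i) = words k i.
Proof.
rewrite /word_sphere (pmap_filter (@insubK _ _ _)).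
apply/all_filterP/allP => w; rewrite mem_words => /and3P[rw _ _].
by rewrite /= insubT.
Qed.

Lemma mem_word_sphere k i g :
  (g \in word_sphere k i) = (size g == k) && ((k == 0%N) || (head_side g == i)).
Proof.
by rewrite -(mem_map val_inj) map_word_sphere mem_words fp_reduced.
Qed.

Lemma uniq_word_sphere k i : uniq (word_sphere k i).
Proof. by rewrite -(map_inj_uniq val_inj) map_word_sphere uniq_words. Qed.

Lemma size_word_sphere k i : size (word_sphere k i) = nb_words k i.
Proof. by rewrite -(size_map val) map_word_sphere size_words. Qed.

Fixpoint word_ball n : seq G :=
  if n is n'.+1 then word_ball n' ++ (word_sphere n true ++ word_sphere n false)
  else word_sphere 0 true.

Lemma mem_word_ball n g : (g \in word_ball n) = (size g <= n)%N.
Proof.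
elim: n => [|n IH]; first by rewrite mem_word_sphere andbT leqn0.
rewrite /= !mem_cat IH !mem_word_sphere [RHS]leq_eqVlt ltnS /=.
by case: head_side; rewrite andbT andbF ?orbF orbC.
Qed.

Lemma uniq_word_ball n : uniq (word_ball n).
Proof.
elim: n => [|n IH]; first exact: uniq_word_sphere.
rewrite /= !cat_uniq IH !uniq_word_sphere !andbT /=; apply/andP; split; apply/hasPn => g.
  rewrite mem_cat !mem_word_sphere mem_word_ball -andb_orr.
  by move=> /andP[/eqP-> _]; rewrite ltnn.
by rewrite !mem_word_sphere /= => /andP[_ /eqP->]; rewrite andbF.
Qed.

Hypotheses (cardG1 : (1 < #|G1|)%N) (cardG2 : (1 < #|G2|)%N).

Lemma nb_letters_gt0 s : (0 < nb_letters G1 G2 s)%N.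
Proof. by case: s; rewrite /nb_letters -ltnS prednK // ltnW. Qed.

Lemma nb_words_gt0 k i : (0 < nb_words k i)%N.
Proof. by elim: k i => //= k IH i; rewrite muln_gt0 nb_letters_gt0 IH. Qed.

Variable R : realType.

Definition nb_type g : R := (nb_words (size g) (head_side g))%:R.

Lemma nb_type_gt0 g : 0 < nb_type g.
Proof. by rewrite ltr0n nb_words_gt0. Qed.

Lemma nb_type_word_sphere k i g : g \in word_sphere k i -> nb_type g = (nb_words k i)%:R.
Proof.
by rewrite mem_word_sphere /nb_type => /andP[/eqP->]; case: k => //= k /eqP->.
Qed.

Lemma sum_word_sphere_nb_typeV k i : \sum_(g <- word_sphere k i) (nb_type g)^-1 = 1.
Proof.
rewrite (eq_big_seq (fun=> (nb_words k i)%:R^-1)) => [|g /nb_type_word_sphere -> //].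
rewrite big_const_seq count_predT size_word_sphere iter_addr_0 -[LHS]mulr_natl divff //.
by rewrite pnatr_eq0 -lt0n nb_words_gt0.
Qed.

(** Each type has total weight 1, so the sum counts the types in the ball: one for the identity and
    two for each positive length. *)
Lemma sum_word_ball_nb_typeV n : \sum_(g <- word_ball n) (nb_type g)^-1 = (n.*2.+1)%:R.
Proof.
elim: n => [|n IH]; first exact: sum_word_sphere_nb_typeV.
by rewrite /= !big_cat IH !sum_word_sphere_nb_typeV /= [RHS](natrD R 2 n.*2.+1) addrC.
Qed.

End Spheres.

(** * The Markov operator of the walk and its action on functions of the type *)

Section Transition.
Variables (R : realType) (G1 G2 : finGroupType).
Hypotheses (cardG1 : (1 < #|G1|)%N) (cardG2 : (1 < #|G2|)%N).
Variable p : R.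
Hypothesis p01 : 0 < p < 1.
Local Notation letter := (G1 + G2)%type.
Local Notation G := (free_prod G1 G2).
Implicit Types (l c : letter) (g : G) (s i : bool) (k n : nat) (F H : G -> R).

Definition side_weight s : R := if s then p else 1 - p.

Definition nbR s : R := (nb_letters G1 G2 s)%:R.

(** The probability of the step [elt l]. Both trivial letters represent the identity and get weight
    0, so a sum over all letters counts each step once. *)
Definition weight l : R :=
  if letter_is1 l then 0 else side_weight (letter_side l) / nbR (letter_side l).

(** The Markov operator: its [n]-th iterate at [g] is the mean of [F] at time [n] for the walk
    started at [g]. *)
Definition transition F g : R := \sum_l weight l * F (g * elt l)%g.

Lemma side_weight_gt0 s : 0 < side_weight s.
Proof. by case/andP: p01 => ? ?; case: s; rewrite /side_weight; lra. Qed.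

Lemma side_weightN s : side_weight (~~ s) = 1 - side_weight s.
Proof. by case: s; rewrite /side_weight /=; ring. Qed.

Lemma nbR_ge1 s : 1 <= nbR s.
Proof. by rewrite ler1n nb_letters_gt0. Qed.

Lemma nbR_gt0 s : 0 < nbR s.
Proof. exact: lt_le_trans (nbR_ge1 s). Qed.

Lemma weight_ge0 l : 0 <= weight l.
Proof.
rewrite /weight; case: ifP => // _.
by rewrite divr_ge0 // ltW // ?side_weight_gt0 ?nbR_gt0.
Qed.

(** On each side the step is uniform on the nontrivial letters, hence a full coset sum minus the
    term of the trivial letter. *)
Lemma transition_sides F g : transition F g =
  \sum_s side_weight s / nbR s * (coset_sum F s g - F g).
Proof.
rewrite /transition (partition_big (@letter_side G1 G2) xpredT) //=.
apply: eq_bigr => s _; rewrite coset_sumE addrC addrA addNr add0r mulr_sumr.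
rewrite [LHS]big_mkcond [RHS]big_mkcond; apply: eq_bigr => l _.
rewrite /nontriv inE /=; case: eqP => //= <-; rewrite /weight.
by case: ifP; rewrite ?mul0r.
Qed.

Lemma sum_bool (V : nmodType) (f : bool -> V) : \sum_s f s = f true + f false.
Proof. by rewrite big_bool. Qed.

Lemma transition_cst (a : R) g : transition (fun=> a) g = a.
Proof.
rewrite transition_sides sum_bool !coset_sumE !sumr_const !card_nontriv.
rewrite -!(mulr_natl a) -!/(nbR _) /side_weight.
have := nbR_gt0 true; have := nbR_gt0 false => ? ?.
by field; rewrite !gt_eqF.
Qed.

Lemma sum_weight : \sum_l weight l = 1.
Proof.
rewrite -(transition_cst 1 1%g); apply: eq_bigr => l _; exact/esym/mulr1.
Qed.

Lemma transitionD F H g :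
  transition (fun x => F x + H x) g = transition F g + transition H g.
Proof. by rewrite /transition -big_split; apply: eq_bigr => l _; exact: mulrDr. Qed.

Lemma transitionZ (a : R) F g : transition (fun x => a * F x) g = a * transition F g.
Proof. by rewrite /transition mulr_sumr; apply: eq_bigr => l _; exact: mulrCA. Qed.

Lemma ler_transition F H g : (forall x, F x <= H x) -> transition F g <= transition H g.
Proof.
by move=> FH; apply: ler_sum => l _; rewrite ler_wpM2l ?weight_ge0.
Qed.

Lemma ler_iter_transition n F H g :
  (forall x, F x <= H x) -> iter n transition F g <= iter n transition H g.
Proof. by elim: n g => //= n IH g FH; apply: ler_transition => x; exact: IH. Qed.

Lemma iter_transitionD n F H g : iter n transition (fun x => F x + H x) g =
  iter n transition F g + iter n transition H g.
Proof.
elim: n g => //= n IH g; rewrite -transitionD; congr transition.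
by apply/funext => x; exact: IH.
Qed.

Lemma iter_transitionZ n (a : R) F g :
  iter n transition (fun x => a * F x) g = a * iter n transition F g.
Proof.
elim: n g => //= n IH g; rewrite -transitionZ; congr transition.
by apply/funext => x; exact: IH.
Qed.

Lemma iter_transition_cst n (a : R) g : iter n transition (fun=> a) g = a.
Proof.
elim: n g => //= n IH g; rewrite -[RHS](transition_cst a g); congr transition.
exact/funext.
Qed.

Lemma iter_transition_sum n (I : Type) (r : seq I) (P : pred I) (F : I -> G -> R) g :
  iter n transition (fun x => \sum_(j <- r | P j) F j x) g =
  \sum_(j <- r | P j) iter n transition (F j) g.
Proof.
elim: r => [|j r IH].
  by under eq_fun do rewrite big_nil; rewrite iter_transition_cst big_nil.
under eq_fun do rewrite big_cons; rewrite big_cons.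
by case: (P j); rewrite ?iter_transitionD IH.
Qed.

(* Steps have length at most 1, so [n] steps from [g] stay in the ball. *)
Lemma eq_iter_transition n F H g :
  (forall x : G, (size x <= size g + n)%N -> F x = H x) ->
  iter n transition F g = iter n transition H g.
Proof.
elim: n g => [|n IH] g FH /=; first by rewrite FH ?addn0.
apply: eq_bigr => l _; congr (_ * _); apply: IH => x xn; apply: FH.
by rewrite (leq_trans xn) // addnS -addSn leq_add2r size_mul_elt.
Qed.

Section TypeFunctions.
Variable phi : bool -> nat -> R.
Hypothesis phi0 : phi true 0 = phi false 0.

Definition type_fun (phi : bool -> nat -> R) g : R := phi (head_side g) (size g).

(** At positive length, among the letters on the side [s] of the last one, one cancels it and the
    [nbR s - 1] others only change it; a letter of the other side lengthens the word. At the
    identity the step chooses the first side. *)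
Definition type_transition (phi : bool -> nat -> R) i k : R :=
  if k is k'.+1 then let s := last_side i k in
    side_weight s / nbR s * (phi i k' + (nbR s - 1) * phi i k)
    + side_weight (~~ s) * phi i k.+1
  else \sum_s side_weight s * phi s 1%N.

Lemma coset_sum_type s g :
  (size g == 0%N) || (s != last_side (head_side g) (size g)) ->
  coset_sum (type_fun phi) s g = type_fun phi g +
    nbR s * phi (if size g == 0%N then s else head_side g) (size g).+1.
Proof.
move=> gs; rewrite coset_sumE; congr (_ + _).
rewrite /nbR -card_nontriv mulr_natl -sumr_const; apply: eq_big => // l.
rewrite /nontriv inE => /andP[/eqP ls l1]; rewrite /type_fun mul_elt; last first.
  by rewrite reduced_rcons l1 ls gs.
by rewrite size_rcons; case: (fp_word g) => //=; rewrite ls.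
Qed.

Lemma transition_type g :
  transition (type_fun phi) g = type_transition phi (head_side g) (size g).
Proof.
rewrite transition_sides.
have [->|[g' [c [gE wE]]]] := free_prodP g.
  apply: eq_bigr => s _; rewrite coset_sum_type // addrAC subrr add0r /= mulrA.
  by rewrite divfK // gt_eqF ?nbR_gt0.
move=> r; have := r; rewrite reduced_rcons => /andP[_ g's].
have cs : letter_side c = last_side (head_side g) (size g).
  rewrite wE size_rcons; apply: last_head_side.
  by move: r; rewrite /reduced => /andP[].
have gS : size g = (size g').+1 by rewrite wE size_rcons.
have s0 : (if size g' == 0%N then letter_side c else head_side g') = head_side g.
  by rewrite wE; case: (fp_word g').
(* If [g'] is the identity, its [head_side] is a default value and [phi0] is what gives the
   equality. *)
have g'F : type_fun phi g' = phi (head_side g) (size g').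
  rewrite /type_fun -s0; case: eqP => // ->.
  by case: (head_side g'); case: letter_side.
(* On the side of [c] the coset of [g] is that of [g'], to which all nontrivial letters of this side
   can be appended. *)
have csE : coset_sum (type_fun phi) (letter_side c) g =
    phi (head_side g) (size g') + nbR (letter_side c) * phi (head_side g) (size g).
  by rewrite {1}gE coset_sumM coset_sum_type // s0 g'F gS.
have csN : coset_sum (type_fun phi) (~~ letter_side c) g = type_fun phi g +
    nbR (~~ letter_side c) * phi (head_side g) (size g).+1.
  rewrite coset_sum_type ?gS //= -gS -cs; by case: (letter_side c).
rewrite sum_bool [in RHS]gS /type_transition -gS -cs /=.
set s := letter_side c in csE csN *.
transitivity (side_weight s / nbR s * (coset_sum (type_fun phi) s g - type_fun phi g) +
  side_weight (~~ s) / nbR (~~ s) *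
   (coset_sum (type_fun phi) (~~ s) g - type_fun phi g)).
  by case: s {csE csN} => //; rewrite addrC.
rewrite csE csN /type_fun.
have := nbR_gt0 s; have := nbR_gt0 (~~ s) => ? ?.
by field; rewrite !gt_eqF.
Qed.

End TypeFunctions.

(** At length 0 [type_transition] ignores the side, so compatibility at the identity persists under
    iteration. *)
Lemma iter_type_transition0 n phi : phi true 0%N = phi false 0%N ->
  iter n type_transition phi true 0%N = iter n type_transition phi false 0%N.
Proof. by case: n. Qed.

Lemma iter_transition_type n phi g : phi true 0%N = phi false 0%N ->
  iter n transition (type_fun phi) g = type_fun (iter n type_transition phi) g.
Proof.
move=> phi0; elim: n g => //= n IH g.
rewrite -[RHS]transition_type ?iter_type_transition0 //; congr transition.
exact/funext.
Qed.

End Transition.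

(** * A function of the type with constant drift, at bounded distance from the length *)

Section Potential.
Variables (R : realType) (G1 G2 : finGroupType).
Hypotheses (cardG1 : (1 < #|G1|)%N) (cardG2 : (1 < #|G2|)%N).
Hypothesis cardG12 : ~ (#|G1| = 2%N /\ #|G2| = 2%N).
Variable p : R.
Hypothesis p01 : 0 < p < 1.
Local Notation G := (free_prod G1 G2).
Implicit Types (g : G) (s i : bool) (k n : nat) (F H : G -> R).

Local Notation w := (side_weight p).
Local Notation c := (nbR R G1 G2).

(* The side of the last letter is (away from the identity) a two-state chain,
   leaving side [s] with probability [w (~~ s) + w s / c s]; [speed] is the mean
   of the length increment [w (~~ s) - w s / c s] under its stationary law. *)
Definition speed : R := 2 * w true * w false * (1 - (c true * c false)^-1) /
  (1 + w true / c true + w false / c false).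

(** Here the exclusion of two factors of order 2 enters; it makes the speed and the volume positive
    and the errors below decay. *)
Lemma nbR_prod_ge2 : 2 <= c true * c false.
Proof.
rewrite /nbR -natrM ler_nat /=.
have := nb_letters_gt0 cardG1 cardG2 true; have := nb_letters_gt0 cardG1 cardG2 false.
move: cardG12 cardG1 cardG2; rewrite /nb_letters.
case: #|G1| => [|[|[|a]]] //; case: #|G2| => [|[|[|b]]] //= H *.
by case: H.
Qed.

Let w_gt0 s : 0 < w s := side_weight_gt0 p01 s.
Let c_gt0 s : 0 < c s := nbR_gt0 R cardG1 cardG2 s.

Let den_gt0 : 0 < 1 + w true / c true + w false / c false.
Proof. by rewrite !addr_gt0 // divr_gt0. Qed.

Lemma speed_gt0 : 0 < speed.
Proof.
rewrite /speed divr_gt0 // mulr_gt0 ?mulr_gt0 // subr_gt0 invf_lt1 ?mulr_gt0 //.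
by apply: lt_le_trans nbR_prod_ge2; rewrite ltr1n.
Qed.

(* The increments are chosen so that [transition] increases [potential] by
   exactly [speed] everywhere, including at the identity. *)
Fixpoint increment i k : R :=
  if k is k'.+1 then let s := last_side i k in
    (speed + w s / c s * increment i k') / w (~~ s)
  else speed.

Definition potential i k : R := \sum_(j < k) increment i j.

Lemma potentialS i k : potential i k.+1 = potential i k + increment i k.
Proof. by rewrite /potential big_ord_recr. Qed.

Lemma potential0 i : potential i 0 = 0.
Proof. by rewrite /potential big_ord0. Qed.

Lemma type_transition_potential i k :
  type_transition G1 G2 p potential i k = potential i k + speed.
Proof.
case: k => [|k].
  rewrite /= sum_bool !potentialS !potential0 /= /side_weight /=; ring.
rewrite /type_transition; set s := last_side i k.+1.
rewrite !potentialS [increment i k.+1]/= -/s.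
have := c_gt0 s; have := w_gt0 s; have := w_gt0 (~~ s); rewrite side_weightN => ? ? ?.
by field; rewrite !gt_eqF.
Qed.

Lemma transition_potential g :
  transition p (type_fun potential) g = type_fun potential g + speed.
Proof. by rewrite transition_type // ?potential0 // type_transition_potential. Qed.

(** The factor multiplying the error of [increment] at each step. A single one may exceed 1, but two
    consecutive ones have product [1/(ab)], at most [1/2]. *)
Let ratio s : R := w s / c s / w (~~ s).

Let ratio_gt0 s : 0 < ratio s.
Proof. by rewrite /ratio !divr_gt0. Qed.

Let ratioM s : ratio s * ratio (~~ s) = (c true * c false)^-1.
Proof.
rewrite /ratio; have := c_gt0 true; have := c_gt0 false.
have := w_gt0 true; have := w_gt0 false => ? ? ? ?.
by case: s => /=; field; rewrite !gt_eqF.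
Qed.

(** Opposite values on the two sides make the periodic increments average to 1. The equation
    [limit_incrE] at side [true] forces [e]; the one at side [false] then holds by the value of
    [speed]. *)
Let drift_corr s : R := let e := (speed + w true / c true - w false) /
   (w false + w true / c true) in if s then e else - e.

(* The 2-periodic solution of the recursion for [increment]. *)
Let limit_incr s : R := 1 + drift_corr s.

Let limit_incrE s : w (~~ s) * limit_incr s = speed + w s / c s * limit_incr (~~ s).
Proof.
rewrite /limit_incr /drift_corr /speed /side_weight.
have := c_gt0 true; have := c_gt0 false.
have := w_gt0 true; have := w_gt0 false.
set C := c true; set D := c false; rewrite /side_weight => q0 p0 D0 C0.
case: s => /=.
  field.
  rewrite -!/C -!/D; do ?[apply/andP; split]; rewrite gt_eqF //; nra.
field.
rewrite -!/C -!/D; do ?[apply/andP; split]; rewrite gt_eqF //; nra.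
Qed.

Let incr_err i k : R := increment i k - limit_incr (last_side i k).

Let incr_errS i k : incr_err i k.+1 = ratio (last_side i k.+1) * incr_err i k.
Proof.
rewrite /incr_err [increment _ _]/= ; set s := last_side i k.+1.
have -> : last_side i k = ~~ s by rewrite /s last_sideS negbK.
have -> : limit_incr s = (speed + w s / c s * limit_incr (~~ s)) / w (~~ s).
  by rewrite -limit_incrE [w _ * _]mulrC mulfK // gt_eqF.
by rewrite /ratio -mulrBl opprD addrACA subrr add0r -mulrBr mulrAC.
Qed.

(* [coef s * e] is the sum of the geometrically decaying errors that start with
   an error [e] at a last letter of side [s]. *)
Let coef s : R := (1 + ratio (~~ s)) / (1 - (c true * c false)^-1).

Let coefE s : coef s = 1 + coef (~~ s) * ratio (~~ s).
Proof.
have : (c true * c false)^-1 < 1.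
  rewrite invf_lt1 ?mulr_gt0 //.
  by apply: lt_le_trans nbR_prod_ge2; rewrite ltr1n.
rewrite /coef negbK -(ratioM s) => r1.
by field; rewrite gt_eqF // subr_gt0.
Qed.

(** The periodic part of the increments sums to [k] plus a bounded oscillation. The errors
    telescope: by [coefE] and [incr_errS], each is the difference of two consecutive values of
    [coef] times error. *)
Let potentialE i k : potential i k = k%:R + (odd k)%:R * drift_corr (~~ i)
  + coef (~~ i) * incr_err i 0 - coef (last_side i k) * incr_err i k.
Proof.
elim: k => [|k IH].
  rewrite potential0 /= /last_side /= addbT; ring.
rewrite potentialS IH incr_errS last_sideS [coef (last_side i k)]coefE.
have -> : increment i k = incr_err i k + 1 + drift_corr (last_side i k).
  by rewrite /incr_err /limit_incr; ring.
rewrite -natr1; have -> : drift_corr (last_side i k) =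
    ((odd k.+1)%:R - (odd k)%:R) * drift_corr (~~ i).
  by clear IH; rewrite /last_side /drift_corr /=; case: (odd k); case: i => /=; ring.
ring.
Qed.

(** The prefactor is stable under the recursion: [ratio s * (1 + ratio (~~ s))] equals
    [ratio s + 1/(ab)], at most [1 + ratio s]. *)
Let ler_incr_err i k :
  `|incr_err i k| <= (1 + ratio (last_side i k)) * `|incr_err i 0|.
Proof.
elim: k => [|k IH]; first by rewrite ler_peMl // lerDl ltW.
rewrite incr_errS normrM ger0_norm ?(ltW (ratio_gt0 _)) //.
apply: le_trans (ler_wpM2l (ltW (ratio_gt0 _)) IH) _.
rewrite mulrA ler_wpM2r // mulrDr mulr1 addrC lerD2r.
have -> : last_side i k = ~~ last_side i k.+1 by rewrite last_sideS negbK.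
rewrite ratioM invf_le1 ?mulr_gt0 //.
by apply: le_trans nbR_prod_ge2; rewrite ler1n.
Qed.

Lemma potential_bounded : exists2 C : R, 0 <= C &
  forall i k, `|potential i k - k%:R| <= C.
Proof.
pose D i : R := `|drift_corr (~~ i)| + `|coef (~~ i) * incr_err i 0| +
  \sum_s `|coef s| * ((1 + ratio s) * `|incr_err i 0|).
have D0 i : 0 <= D i.
  rewrite /D !addr_ge0 // sumr_ge0 // => s _.
  by rewrite !mulr_ge0 // addr_ge0 // ltW.
exists (D true + D false) => [|i k]; first exact: addr_ge0.
apply: (@le_trans _ _ (D i)); last first.
  by case: i; rewrite ?lerDl ?lerDr.
rewrite potentialE; set a := _ * drift_corr _; set b := coef _ * _; set e := coef _ * _.
have -> : k%:R + a + b - e - k%:R = a + b - e by ring.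
apply: le_trans (ler_normB _ _) _; rewrite /D -/b; apply: lerD.
  apply: le_trans (ler_normD _ _) _; rewrite lerD2r /a.
  by case: (odd k); rewrite ?mul1r ?mul0r ?normr0.
rewrite (bigD1 (last_side i k)) //= ler_wpDr //.
  by apply: sumr_ge0 => s _; rewrite !mulr_ge0 // addr_ge0 // ltW.
by rewrite /e normrM ler_wpM2l // ler_incr_err.
Qed.

End Potential.

(** * Mean and variance of the potential along the walk *)

Section Moments.
Variables (R : realType) (G1 G2 : finGroupType).
Hypotheses (cardG1 : (1 < #|G1|)%N) (cardG2 : (1 < #|G2|)%N).
Hypothesis cardG12 : ~ (#|G1| = 2%N /\ #|G2| = 2%N).
Variable p : R.
Hypothesis p01 : 0 < p < 1.
Local Notation G := (free_prod G1 G2).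
Implicit Types (g : G) (s i : bool) (k n : nat) (F H : G -> R).

Local Notation gamma := (speed G1 G2 p).
Local Notation f := (type_fun (potential G1 G2 p) : G -> R).

Lemma potential_one : f 1%g = 0.
Proof. exact: potential0. Qed.

Lemma iter_transition_potential n : iter n (transition p) f 1%g = gamma * n%:R.
Proof.
elim: n => [|n IH]; first by rewrite /= potential_one mulr0.
rewrite iterSr -natr1 mulrDr mulr1 -IH.
rewrite -[gamma in RHS](iter_transition_cst cardG1 cardG2 p n _ 1%g).
rewrite -iter_transitionD; congr (iter _ _ _ _).
apply/funext => g; exact: transition_potential.
Qed.

Variable C : R.
Hypothesis C0 : 0 <= C.
Hypothesis potential_near : forall i k, `|potential G1 G2 p i k - k%:R| <= C.

Lemma potential_size g : `|f g - (size g)%:R| <= C.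
Proof. exact: potential_near. Qed.

(** The length changes by at most 1, and each of the two potentials is within [C] of its length. *)
Lemma potential_step g l : `|f (g * elt l)%g - f g - gamma| <= 2 * C + 1 + gamma.
Proof.
have := potential_size g; have := potential_size (g * elt l)%g.
have : (size (fp_word (g * elt l)%g))%:R <= (size g)%:R + 1 :> R.
  by rewrite natr1 ler_nat size_mul_elt.
have : (size g)%:R <= (size (fp_word (g * elt l)%g))%:R + 1 :> R.
  by rewrite natr1 ler_nat size_mul_elt_ge.
have := speed_gt0 cardG1 cardG2 cardG12 p01.
rewrite !ler_norml => g0 ? ? /andP[? ?] /andP[? ?]; apply/andP; split; lra.
Qed.

(** Given the position at time [n], the centred increment has mean 0, so the cross term of the
    square vanishes and each step adds at most [K]. *)
Lemma iter_transition_variance n :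
  iter n (transition p) (fun g => (f g - gamma * n%:R) ^+ 2) 1%g
    <= (2 * C + 1 + gamma) ^+ 2 * n%:R.
Proof.
set K := (_ ^+ 2).
elim: n => [|n IH]; first by rewrite /= potential_one !mulr0 subr0 expr0n.
rewrite iterSr.
apply: (@le_trans _ _ (iter n (transition p)
    (fun g => (f g - gamma * n%:R) ^+ 2 + K) 1%g)); last first.
  by rewrite iter_transitionD iter_transition_cst // -natr1 mulrDr mulr1 lerD2r.
apply: ler_iter_transition => // g.
have mean0 : \sum_l weight p l * (f (g * elt l)%g - f g - gamma) = 0.
  have := transition_potential cardG1 cardG2 p01 g.
  rewrite /transition => E; under eq_bigr do rewrite !mulrBr.
  rewrite !sumrB -!mulr_suml sum_weight // !mul1r E; ring.
apply: (@le_trans _ _ (\sum_l (weight p l * (f g - gamma * n%:R) ^+ 2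
   + 2 * (f g - gamma * n%:R) * (weight p l * (f (g * elt l)%g - f g - gamma))
   + weight p l * K))); last first.
  by rewrite !big_split /= -!mulr_suml -mulr_sumr mean0 sum_weight // mulr0 addr0 !mul1r.
apply: ler_sum => l _; rewrite [_ * (weight _ _ * _)]mulrCA -!mulrDr.
apply: ler_wpM2l; first exact: weight_ge0.
set u := f (g * elt l)%g - f g - gamma.
have -> : f (g * elt l)%g - gamma * n.+1%:R = f g - gamma * n%:R + u.
  by rewrite /u -natr1; ring.
have : u ^+ 2 <= K.
  rewrite /K -[u ^+ 2]real_normK ?num_real // ler_sqr ?nnegrE //; last first.
    by have := speed_gt0 cardG1 cardG2 cardG12 p01; move: C0 => *; lra.
  exact: potential_step.
lra.
Qed.

End Moments.

(** * The step law as weights of letters *)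

Section Cylinders.
Variables (R : realType) (G1 G2 : finGroupType).
Hypotheses (cardG1 : (1 < #|G1|)%N) (cardG2 : (1 < #|G2|)%N).
Variable p : R.
Hypothesis p01 : 0 < p < 1.
Local Notation G := (free_prod G1 G2).
Local Notation letter := (G1 + G2)%type.
Implicit Types (g : G) (l : letter) (t : seq letter) (n : nat).

Definition Sigma_side (s : bool) : set G := if s then Sigma1 G1 G2 else Sigma2 G1 G2.

(** Exhibits the generating sets as finite, so that [fset_set] in [unif] does not take its default
    value. *)
Lemma Sigma_sideE s :
  Sigma_side s = [set` [fset g in map (@elt G1 G2) (enum (@nontriv G1 G2 s))]%fset].
Proof.
apply/seteqP; split => g /=; rewrite !inE /=.
  case: s => -[a a1 <-].
    by apply/mapP; exists (inl a); rewrite ?mem_enum ?inE.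
  by apply/mapP; exists (inr a); rewrite ?mem_enum ?inE.
move=> /mapP[l]; rewrite mem_enum inE => /andP[/eqP <- l1] ->.
by case: l l1 => a a1; exists a.
Qed.

Lemma card_Sigma_side s : #|` fset_set (Sigma_side s)| = nb_letters G1 G2 s.
Proof.
rewrite Sigma_sideE set_fsetK card_fseq undup_id ?size_map -?cardE ?card_nontriv //.
rewrite map_inj_in_uniq ?enum_uniq // => k l.
rewrite !mem_enum => /andP[_ k1] /andP[_ l1].
exact: elt_inj.
Qed.

Lemma Sigma_side_elt s l : Sigma_side s (elt l) <-> nontriv s l.
Proof.
rewrite Sigma_sideE /= !inE; split => [/mapP[k]|l1]; last first.
  by apply/mapP; exists l; rewrite ?mem_enum.
rewrite mem_enum => ks; have [l1|l1] := boolP (letter_is1 l).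
  move: ks => /andP[_ k1]; rewrite (elt_is1 l1) => /(congr1 (@fp_word _ _)).
  by rewrite elt_nontriv.
by move=> /(elt_inj l1) ->//; case/andP: ks.
Qed.

Lemma unif_Sigma_side s l :
  unif R (Sigma_side s) (elt l) = (nontriv s l)%:R / nbR R G1 G2 s.
Proof.
rewrite /unif card_Sigma_side indicE; congr (_%:R / _).
by congr nat_of_bool; apply/idP/idP; rewrite inE => /Sigma_side_elt.
Qed.

Lemma mu_p_elt l : mu_p G1 G2 p (elt l) = weight p l.
Proof.
rewrite /mu_p -[Sigma1 _ _]/(Sigma_side true) -[Sigma2 _ _]/(Sigma_side false).
rewrite !unif_Sigma_side /weight /nontriv !inE /side_weight.
by case: ifP => l1; case: letter_side; rewrite /= ?mul0r ?mulr0 ?addr0 ?add0r // mul1r.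
Qed.

Lemma mu_p_out g : ~ Sigma G1 G2 g -> mu_p G1 G2 p g = 0.
Proof.
move=> /not_orP[g1 g2]; rewrite /mu_p /unif !indicE.
by rewrite !memNset // !mul0r !mulr0 addr0.
Qed.

End Cylinders.

(** * From the probability space to iterates of the transition operator *)

Section Paths.
Variables (R : realType) (G1 G2 : finGroupType).
Hypotheses (cardG1 : (1 < #|G1|)%N) (cardG2 : (1 < #|G2|)%N).
Variable p : R.
Hypothesis p01 : 0 < p < 1.
Variables (d : measure_display) (Omega : measurableType d) (P : probability Omega R).
Variable x : nat -> Omega -> free_prod G1 G2.
Hypothesis x_iid : iid_of_law P x (mu_p G1 G2 p).
Local Notation G := (free_prod G1 G2).
Local Notation letter := (G1 + G2)%type.
Implicit Types (g : G) (l : letter) (t : seq letter) (n : nat) (U : set G).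

Definition seq_prod t : G := (\prod_(l <- t) elt l)%g.

Definition step_event t j : set Omega :=
  x j @^-1` [set elt (nth (triv_letter G1 G2 true) t j)].

(** An intersection over a finite set of times, the form in which [iid_of_law] states
    independence. *)
Definition cylinder t : set Omega :=
  \bigcap_(j in [set` [fset j in iota 0 (size t)]%fset]) step_event t j.

Lemma measurable_step_event t j : measurable (step_event t j).
Proof. by case: x_iid => mx _ _; exact: mx. Qed.

Lemma measurable_cylinder t : measurable (cylinder t).
Proof.
apply: fin_bigcap_measurable => [|j _]; [exact: finite_fset|exact: measurable_step_event].
Qed.

Lemma cylinderP t w : cylinder t w <->
  forall j, (j < size t)%N -> x j w = elt (nth (triv_letter G1 G2 true) t j).
Proof.
split=> [H j jt|H j /=]; first by apply: H; rewrite /= !inE mem_iota.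
by rewrite !inE mem_iota => /H.
Qed.

Lemma prob_cylinder t : P (cylinder t) = (\prod_(l <- t) weight p l)%:E.
Proof.
case: x_iid => _ law indep.
rewrite /cylinder /step_event.
rewrite (indep [fset j in iota 0 (size t)]%fset
  (fun j => [set elt (nth (triv_letter G1 G2 true) t j)])).
rewrite (perm_big (iota 0 (size t))) /=; last first.
  by apply: uniq_perm; rewrite ?fset_uniq ?iota_uniq // => j; rewrite !inE.
under eq_bigr do rewrite law mu_p_elt //.
rewrite -prodEFin (big_nth (triv_letter G1 G2 true)) /index_iota subn0.
by rewrite prodEFin.
Qed.

(* The paths that start with [t] and are in [U] at time [size t + n], as a finite
   union of cylinders: this spares the measurability of [walk]. *)
Fixpoint path_event U n t : set Omega :=
  if n is n'.+1 then \big[setU/set0]_l path_event U n' (rcons t l)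
  else if `[< U (seq_prod t) >] then cylinder t else set0.

Lemma measurable_path_event U n t : measurable (path_event U n t).
Proof.
elim: n t => [|n IH] t /=; first by case: ifP => _; [exact: measurable_cylinder|].
exact: bigsetU_measurable.
Qed.

Lemma seq_prod_rcons t l : seq_prod (rcons t l) = (seq_prod t * elt l)%g.
Proof. exact: big_rcons. Qed.

(** Union bound over the next letter; Borel-Cantelli takes only an upper bound. *)
Lemma prob_path_event U n t : (P (path_event U n t) <=
  (\prod_(l <- t) weight p l * iter n (transition p) \1_U (seq_prod t))%:E)%E.
Proof.
elim: n t => [|n IH] t /=.
  rewrite indicE; case: asboolP => Ut.
    by rewrite mem_set // mulr1 prob_cylinder.
  by rewrite memNset // mulr0 measure0.
have sub (r : seq letter) : (P (\big[setU/set0]_(l <- r) path_event U n (rcons t l)) <=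
    \sum_(l <- r) P (path_event U n (rcons t l)))%E.
  elim: r => [|l r IHr]; first by rewrite !big_nil measure0.
  rewrite !big_cons; apply: (@le_trans _ _ (P (path_event U n (rcons t l)) +
    P (\big[setU/set0]_(l <- r) path_event U n (rcons t l)))%E); last exact: leeD2l.
  apply: measureU2; first exact: measurable_path_event.
  by apply: bigsetU_measurable => *; exact: measurable_path_event.
apply: (le_trans (sub _)); rewrite /transition mulr_sumr -sumEFin.
apply: lee_sum => l _; apply: (le_trans (IH _)).
by rewrite big_rcons seq_prod_rcons /= mulrA.
Qed.

Lemma path_event_walk U n t w : (forall j, exists l, x j w = elt l) ->
  cylinder t w -> U (walk x (size t + n) w) -> path_event U n t w.
Proof.
move=> xw; elim: n t => [|n IH] t tw /=.
  suff <- : walk x (size t) w = seq_prod t.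
    by rewrite addn0 => Uw; case: asboolP.
  elim/last_ind: t tw => [_|t l IHt]; first by rewrite /seq_prod big_nil.
  rewrite size_rcons seq_prod_rcons => /cylinderP tw /=; congr (_ * _)%g.
    apply: IHt; apply/cylinderP => j jt.
    by rewrite tw ?size_rcons ?nth_rcons ?jt // ltnW.
  by rewrite tw ?size_rcons // nth_rcons ltnn eqxx.
move=> Uw; have [l xl] := xw (size t).
rewrite (bigD1 l) //=; left; apply: IH; last by rewrite size_rcons addSnnS.
apply/cylinderP => j; rewrite size_rcons ltnS nth_rcons leq_eqVlt => /predU1P[->|jt].
  by rewrite ltnn eqxx.
by rewrite jt; move/cylinderP: tw; apply.
Qed.

Lemma prob_step_mem j (r : seq letter) : uniq r -> all (predC (@letter_is1 G1 G2)) r ->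
  P (x j @^-1` [set` map (@elt G1 G2) r]) = (\sum_(l <- r) weight p l)%:E.
Proof.
case: x_iid => mx law _; elim: r => [_ _|l r IH] /=.
  rewrite big_nil -[RHS](measure0 P); congr (P _); by apply/seteqP; split=> w /=.
move=> /andP[lr ur] /andP[l1 r1]; rewrite big_cons EFinD -IH // -mu_p_elt -(law j).
rewrite -measureU //; last first.
  apply/seteqP; split=> // w [/= ->] /mapP[k kr /elt_inj lk].
  move: lr; rewrite lk ?kr //=. exact: (allP r1).
congr (P _); apply/seteqP; split=> w /=; rewrite inE.
  by move=> /predU1P[->|]; [left|right].
by move=> [->|->]; rewrite ?eqxx ?orbT.
Qed.

(** The nontrivial letters carry total mass 1, so the complement of their event is null, and it
    contains this one. *)
Lemma prob_step_out j : P (x j @^-1` [set g | ~ exists l, g = elt l]) = 0%E.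
Proof.
case: x_iid => mx _ _; apply/eqP; rewrite -measure_le0.
pose r := enum (predC (@letter_is1 G1 G2)).
have r1 : P (x j @^-1` [set` map (@elt G1 G2) r]) = 1%E.
  rewrite prob_step_mem ?enum_uniq //; last by apply/allP => l; rewrite mem_enum.
  rewrite big_enum -(sum_weight cardG1 cardG2 p) big_mkcond; congr EFin.
  by apply: eq_bigr => l _; rewrite inE /weight /=; case: (letter_is1 l).
have : P (~` (x j @^-1` [set` map (@elt G1 G2) r])) = 0%E.
  rewrite probability_setC ?r1 ?subee //; exact: mx.
move=> <-; apply: le_measure; rewrite ?inE.
- exact: mx.
- exact/measurableC/mx.
by move=> w /= nw /mapP[l _ xl]; apply: nw; exists l.
Qed.

End Paths.

(** * From convergence along fourth powers to convergence along all times *)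

Section FourthPowers.
Variable R : realType.

Lemma fourth_power_bracket n : (0 < n)%N ->
  exists2 k, (0 < k)%N & (k ^ 4 <= n < k.+1 ^ 4)%N.
Proof.
case: n => // n _; elim: n => [|n [k k0 /andP[kn nk]]]; first by exists 1%N.
move: nk; rewrite leq_eqVlt => /predU1P[nk|nk].
  by exists k.+1; rewrite // nk leqnn ltn_exp2r ?ltnSn.
by exists k => //; rewrite nk andbT ltnW.
Qed.

Lemma dist_unit_steps (L : nat -> nat) :
  (forall n, (L n.+1 <= (L n).+1)%N /\ (L n <= (L n.+1).+1)%N) ->
  forall n m, `|(L (n + m)%N)%:R - (L n)%:R| <= m%:R :> R.
Proof.
move=> L1 n m; elim: m => [|m IH]; first by rewrite addn0 subrr normr0.
have [up down] := L1 (n + m)%N; rewrite addnS.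
have upR : (L (n + m).+1)%:R <= (L (n + m)%N)%:R + 1 :> R by rewrite natr1 ler_nat.
have downR : (L (n + m)%N)%:R <= (L (n + m).+1)%:R + 1 :> R by rewrite natr1 ler_nat.
by move: IH; rewrite -natr1 !ler_norml => /andP[? ?]; apply/andP; split; lra.
Qed.

(** From [k^4] to any time before [(k+1)^4] there are at most [15 k^3] steps of size at most 1, so
    the error stays of order [k^3], negligible against [n >= k^4]. *)
Lemma cvg_unit_steps (L : nat -> nat) (gamma C : R) : 0 <= gamma -> 0 <= C ->
  (forall n, (L n.+1 <= (L n).+1)%N /\ (L n <= (L n.+1).+1)%N) ->
  (exists k0, forall k, (k0 <= k)%N ->
    `|(L (k ^ 4)%N)%:R - gamma * k%:R ^+ 4| <= k%:R ^+ 3 + C) ->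
  (L n)%:R / n%:R @[n --> \oo] --> gamma.
Proof.
move=> g0 C0 L1 [k0 Lk].
(* The error at [k^4] contributes [1 + C], the moves of [L] since then 15, and those of [gamma * n]
   the remaining [15 * gamma]. *)
pose D := 16 + C + 15 * gamma.
have bound n k : (0 < k)%N -> (k0 <= k)%N -> (k ^ 4 <= n < k.+1 ^ 4)%N ->
    `|(L n)%:R - gamma * n%:R| <= D * k%:R ^+ 3.
  move=> k1 k0k /andP[kn nk].
  have k1R : 1 <= k%:R :> R by rewrite ler1n.
  have := dist_unit_steps L1 (k ^ 4)%N (n - k ^ 4)%N; rewrite subnKC // => Lm.
  have mE : (n - k ^ 4)%:R = n%:R - k%:R ^+ 4 :> R by rewrite natrB // natrX.
  have m_le : n%:R - k%:R ^+ 4 <= 15 * k%:R ^+ 3 :> R.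
    have : n%:R <= (k%:R + 1) ^+ 4 :> R.
      by rewrite natr1 -natrX ler_nat ltnW.
    have : 0 <= k%:R ^+ 2 * (k%:R - 1) :> R by rewrite mulr_ge0 ?sqr_ge0 ?subr_ge0.
    have : 0 <= k%:R * (k%:R - 1) :> R by rewrite mulr_ge0 ?subr_ge0.
    rewrite !mulrBr !mulr1 -exprSr -expr2.
    have -> : (k%:R + 1) ^+ 4 =
        k%:R ^+ 4 + 4 * k%:R ^+ 3 + 6 * k%:R ^+ 2 + 4 * k%:R + 1 :> R by ring.
    move: (k%:R ^+ 4 : R) (k%:R ^+ 3 : R) (k%:R ^+ 2 : R) => *; lra.
  have gm : gamma * (n%:R - k%:R ^+ 4) <= gamma * (15 * k%:R ^+ 3) by rewrite ler_wpM2l.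
  have gm0 : 0 <= gamma * (n%:R - k%:R ^+ 4).
    by rewrite mulr_ge0 // subr_ge0 -natrX ler_nat.
  have C_le : C <= C * k%:R ^+ 3 by rewrite ler_peMr // exprn_ege1.
  have := Lk _ k0k; move: Lm gm gm0; rewrite mE mulrBr.
  rewrite !ler_norml /D => /andP[? ?] ? ? /andP[? ?]; apply/andP; split; lra.
have D0 : 0 < D by rewrite /D; lra.
apply/cvgrPdist_le => e e0.
(* For [k >= K] one has [D <= e * k], which turns the bound [D * k^3] into [e * k^4]. *)
pose K := maxn (maxn k0 1) (Num.truncn (D / e)).+1.
exists (K ^ 4)%N => // n /= Kn.
have n0 : (0 < n)%N by apply: leq_trans Kn; rewrite expn_gt0 !leq_max orbT.
have [k k1 kn] := fourth_power_bracket n0.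
have Kk : (K <= k)%N.
  rewrite -ltnS -(ltn_exp2r _ _ (isT : 0 < 4)%N).
  by case/andP: kn => _; exact: leq_ltn_trans.
have {}bound := bound n k k1 (leq_trans _ Kk) kn.
rewrite distrC; have n0R : 0 < n%:R :> R by rewrite ltr0n.
have -> : (L n)%:R / n%:R - gamma = ((L n)%:R - gamma * n%:R) / n%:R.
  by rewrite mulrBl mulfK // gt_eqF.
rewrite normrM normfV [X in _ / X]ger0_norm ?(ltW n0R) // ler_pdivrMr //.
apply: le_trans (bound _) _; first by rewrite /K !leq_max leqnn.
have k0R : 0 < k%:R :> R by rewrite ltr0n.
have De : D <= e * k%:R.
  rewrite mulrC -ler_pdivrMr // ltW // (lt_le_trans (truncnS_gt _)) // ler_nat.
  by apply: leq_trans Kk; rewrite leq_max leqnn orbT.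
apply: (@le_trans _ _ (e * k%:R * k%:R ^+ 3)).
  by rewrite ler_wpM2r // exprn_ge0 // ltW.
rewrite -mulrA -exprS ler_wpM2l ?(ltW e0) // -natrX ler_nat.
by case/andP: kn.
Qed.

End FourthPowers.

(** * Almost sure convergence of the normalized length *)

Section Drift.
Variables (R : realType) (G1 G2 : finGroupType).
Hypotheses (cardG1 : (1 < #|G1|)%N) (cardG2 : (1 < #|G2|)%N).
Hypothesis cardG12 : ~ (#|G1| = 2%N /\ #|G2| = 2%N).
Variable p : R.
Hypothesis p01 : 0 < p < 1.
Variables (d : measure_display) (Omega : measurableType d) (P : probability Omega R).
Variable x : nat -> Omega -> free_prod G1 G2.
Hypothesis x_iid : iid_of_law P x (mu_p G1 G2 p).
Local Notation G := (free_prod G1 G2).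
Local Notation gamma := (speed G1 G2 p).
Local Notation f := (type_fun (potential G1 G2 p) : G -> R).

(* At time [N = k.+1 ^ 4] the threshold [k.+1 ^ 3] gives a Chebyshev bound of
   order [k ^ -2], and the gap to the next such time is of the same order as the
   threshold. *)
Definition deviation k : set G :=
  [set g | k.+1%:R ^+ 3 <= `|f g - gamma * k.+1%:R ^+ 4|].

Definition deviation_event k : set Omega :=
  path_event x (deviation k) (k.+1 ^ 4)%N [::].

Lemma measurable_deviation_event k : measurable (deviation_event k).
Proof. exact: measurable_path_event x_iid _ _ _. Qed.

(** With [m = k + 1], Chebyshev gives variance [K m^4] over squared threshold [m^6], that is
    [K / m^2]. The factor 2 bounds this by a telescoping term, since [1/m^2 <= 2/(m (m+1))]. *)
Lemma prob_deviation_event : exists2 K : R, 0 <= K &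
  forall k, (P (deviation_event k) <= (K * (k.+1%:R^-1 - k.+2%:R^-1))%:E)%E.
Proof.
have [C C0 fC] := potential_bounded cardG1 cardG2 cardG12 p01.
pose K := (2 * C + 1 + gamma) ^+ 2.
have K0 : 0 <= K by exact: sqr_ge0.
exists (2 * K) => [|k]; first exact: mulr_ge0.
apply: (le_trans (prob_path_event x_iid _ _ _)); rewrite big_nil mul1r lee_fin.
rewrite /seq_prod big_nil; set n := (k.+1 ^ 4)%N.
have k0 : 0 < k.+1%:R :> R by rewrite ltr0n.
apply: (@le_trans _ _ (iter n (transition p)
    (fun g => (k.+1%:R ^+ 6)^-1 * (f g - gamma * n%:R) ^+ 2) 1%g)).
  apply: ler_iter_transition => // g; rewrite indicE.
  have [|gU] := boolP (g \in _); last by rewrite mulr_ge0 ?sqr_ge0 // invr_ge0 exprn_ge0.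
  rewrite inE /deviation /= => gU.
  rewrite mulrC ler_pdivlMr ?exprn_gt0 // mul1r natrX -[_ ^+ 2]real_normK ?num_real //.
  by rewrite (exprM _ 3 2) ler_sqr // nnegrE exprn_ge0 // ltW.
rewrite iter_transitionZ.
apply: (@le_trans _ _ ((k.+1%:R ^+ 6)^-1 * (K * n%:R))).
  rewrite ler_wpM2l ?invr_ge0 ?exprn_ge0 //.
  exact: iter_transition_variance.
rewrite natrX.
have -> : (k.+1%:R ^+ 6)^-1 * (K * k.+1%:R ^+ 4) = K / k.+1%:R ^+ 2.
  by field; rewrite gt_eqF.
have -> : 2 * K * (k.+1%:R^-1 - k.+2%:R^-1) = K * (2 / (k.+1%:R * k.+2%:R)).
  by rewrite -[k.+2%:R]natr1; field; rewrite !gt_eqF // ltr_wpDl.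
rewrite ler_wpM2l // -[k.+2%:R]natr1 -subr_ge0.
have -> : 2 / (k.+1%:R * (k.+1%:R + 1)) - (k.+1%:R ^+ 2)^-1 =
    (k.+1%:R - 1) / (k.+1%:R ^+ 2 * (k.+1%:R + 1)) :> R.
  by field; rewrite !gt_eqF // ltr_wpDl.
by rewrite divr_ge0 ?subr_ge0 ?ler1n // mulr_ge0 ?sqr_ge0 // ltW //.
Qed.

Lemma limsup_deviation_event : P (lim_sup_set deviation_event) = 0%E.
Proof.
have [K K0 PK] := prob_deviation_event.
apply: lim_sup_set_cvg0; first exact: measurable_deviation_event.
apply: (@le_lt_trans _ _ K%:E); last exact: ltry.
apply: lime_le; first by apply: is_cvg_nneseries => *; exact: measure_ge0.
apply: nearW => n.
apply: (@le_trans _ _ (K * (1 - n.+1%:R^-1))%:E); last first.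
  by rewrite lee_fin ler_piMr // gerBl invr_ge0.
elim: n => [|n IH]; first by rewrite big_geq // invr1 subrr mulr0.
rewrite big_nat_recr //=; apply: le_trans (leeD IH (PK n)) _.
by rewrite -EFinD lee_fin -mulrDr addrA subrK.
Qed.

Lemma drift_speed : is_drift P (Sigma G1 G2) x gamma.
Proof.
have [C C0 fC] := potential_bounded cardG1 cardG2 cardG12 p01.
(* Off [out] every step is a letter, which [path_event_walk] and the unit change of length both
   require. *)
pose out := \bigcup_j x j @^-1` [set g | ~ exists l, g = elt l].
have out0 : P.-negligible out.
  apply: negligible_bigcup => j; exists (x j @^-1` [set g | ~ exists l, g = elt l]).
  split=> //; last exact: prob_step_out x_iid _.
  by case: x_iid => mx _ _; exact: mx.
have lim0 : P.-negligible (lim_sup_set deviation_event).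
  exists (lim_sup_set deviation_event); split=> //; last exact: limsup_deviation_event.
  apply: bigcap_measurableType => n _; apply: bigcup_measurable => k _.
  exact: measurable_deviation_event.
apply: negligibleS (negligibleU out0 lim0) => w; apply: contra_notP.
move=> /not_orP[nout nlim] /=.
have steps j : exists l, x j w = elt l.
  by apply: contrapT => nl; apply: nout; exists j.
have {nlim}[k0 Hk0] : exists k0, forall k, (k0 <= k)%N -> ~ deviation_event k w.
  apply: contrapT => H; apply: nlim => n _; apply: contrapT => Hn.
  by apply: H; exists n => k nk kw; apply: Hn; exists k.
under eq_fun do rewrite word_length_Sigma.
apply: (@cvg_unit_steps _ _ _ C) => //.
- exact/ltW/speed_gt0.
- move=> n; have [l /= ->] := steps n.
  by split; [exact: size_mul_elt|exact: size_mul_elt_ge].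
(* [deviation_event k] concerns time [k.+1 ^ 4], hence the shift of the threshold by one. *)
exists k0.+1 => -[//|k]; rewrite ltnS => /Hk0 nk.
have : ~ deviation k (walk x (k.+1 ^ 4)%N w).
  move=> Uk; apply: nk; apply: path_event_walk => //.
  by apply/cylinderP.
rewrite /deviation /= => /negP; rewrite -ltNge => lt.
have := fC (head_side (walk x (k.+1 ^ 4)%N w)) (size (walk x (k.+1 ^ 4)%N w)).
move: lt; rewrite /type_fun; set F := potential _ _ _ _ _; set S := size _.
move=> /ltW; rewrite !ler_norml => /andP[? ?] /andP[? ?]; apply/andP; split; lra.
Qed.

End Drift.

(** * Convolution powers as iterates of the transition operator *)

Lemma fsbig_setT_seq (R : realType) (T : choiceType) (F : T -> R) (r : seq T) :
  uniq r -> (forall a, a \notin r -> F a = 0) ->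
  \sum_(a \in [set: T]) F a = \sum_(a <- r) F a.
Proof.
move=> ur F0; rewrite [RHS]fsbig_seq // -(fsbig_widen [set` r] setT) // => a [_ /= ar].
by apply: F0; apply/negP.
Qed.

Lemma sum_indic_seq (R : realType) (T : choiceType) (F : T -> R) (r : seq T) b :
  uniq r -> \sum_(a <- r) F a * (b == a)%:R = if b \in r then F b else 0.
Proof.
move=> ur; case: ifP => br.
  rewrite (bigD1_seq b) //= eqxx mulr1 big1 ?addr0 // => a.
  by rewrite eq_sym => /negbTE->; rewrite mulr0.
rewrite big1_seq // => a /= ar; case: eqP => [ba|]; rewrite ?mulr0 //.
by rewrite -ba br in ar.
Qed.

Section Convolution.
Variables (R : realType) (G1 G2 : finGroupType).
Hypotheses (cardG1 : (1 < #|G1|)%N) (cardG2 : (1 < #|G2|)%N).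
Variable p : R.
Hypothesis p01 : 0 < p < 1.
Local Notation G := (free_prod G1 G2).
Implicit Types (g : G) (n : nat) (F : G -> R).

Local Notation law := (convolution_pow (mu_p G1 G2 p)).

Lemma convolution_mu_p (nu : G -> R) g :
  convolution nu (mu_p G1 G2 p) g = \sum_l weight p l * nu (g * (elt l)^-1)%g.
Proof.
pose r := [seq (g * (elt l)^-1)%g | l <- enum (predC (@letter_is1 G1 G2))].
rewrite /convolution (fsbig_setT_seq (r := r)).
- rewrite big_map big_enum [LHS]big_mkcond; apply: eq_bigr => l _.
  rewrite invMg invgK mulgKV mu_p_elt // mulrC inE /=.
  by rewrite /weight; case: letter_is1; rewrite ?mul0r.
- rewrite map_inj_in_uniq ?enum_uniq // => k l; rewrite !mem_enum => k1 l1.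
  by move=> /mulgI /invg_inj /elt_inj; apply.
move=> k kr; rewrite mu_p_out ?mulr0 // => /SigmaP[l l1 kl].
move/negP: kr; apply; apply/mapP; exists l; first by rewrite mem_enum.
by rewrite -kl invMg invgK mulKVg.
Qed.

Lemma convolution_powS n g :
  law n.+1 g = \sum_l weight p l * law n (g * (elt l)^-1)%g.
Proof. exact: convolution_mu_p. Qed.

(** The step law is invariant under inversion, so [law n g] is also the chance of reaching the
    identity from [g]. The indicator of the identity being a function of the type, so is [law n]. *)
Lemma convolution_pow_transition n :
  law n = iter n (transition p) (fun g => (g == 1%g)%:R).
Proof.
elim: n => [//|n IH]; apply/funext => g; rewrite convolution_powS iterS -IH.
have inv_inj : injective (@letter_inv G1 G2).
  by move=> [a|a] [b|b] //= [] /invg_inj ->.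
rewrite (reindex_inj inv_inj) /transition; apply: eq_bigr => l _.
rewrite -eltV invgK /weight; congr (_ * _).
by case: l => a; rewrite /= invg_eq1.
Qed.

(** The forward form, started at the identity: it turns sums against [law n] into iterates of
    [transition]. *)
Lemma convolution_pow_indic n g :
  law n g = iter n (transition p) (fun k => (k == g)%:R) 1%g.
Proof.
elim: n g => [|n IH] g; first by rewrite /= eq_sym.
rewrite convolution_powS iterSr.
have -> : transition p (fun k : G => (k == g)%:R) =
    (fun k => \sum_l weight p l * (k == (g * (elt l)^-1)%g)%:R).
  by apply/funext => k; apply: eq_bigr => l _; rewrite (can2_eq (mulgK _) (mulgKV _)).
rewrite iter_transition_sum //.
by apply: eq_bigr => l _; rewrite iter_transitionZ IH.
Qed.

Lemma convolution_pow_sum n F (r : seq G) : uniq r ->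
  \sum_(g <- r) law n g * F g =
  iter n (transition p) (fun k => if k \in r then F k else 0) 1%g.
Proof.
move=> ur; under [in RHS]eq_fun do rewrite -(sum_indic_seq F _ ur).
rewrite iter_transition_sum //; apply: eq_bigr => g _.
by rewrite iter_transitionZ convolution_pow_indic mulrC.
Qed.

Lemma convolution_pow_word_ball n F :
  \sum_(g <- word_ball G1 G2 n) law n g * F g = iter n (transition p) F 1%g.
Proof.
rewrite convolution_pow_sum ?uniq_word_ball //; apply: eq_iter_transition => g.
by rewrite add0n mem_word_ball => ->.
Qed.

Lemma convolution_pow_ge0 n g : 0 <= law n g.
Proof.
rewrite convolution_pow_indic -[leLHS](iter_transition_cst cardG1 cardG2 p n 0 1%g).
exact: ler_iter_transition.
Qed.

Lemma convolution_pow_out n g : g \notin word_ball G1 G2 n -> law n g = 0.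
Proof.
rewrite mem_word_ball => gn; rewrite convolution_pow_indic.
rewrite -[RHS](iter_transition_cst cardG1 cardG2 p n 0 1%g).
apply: eq_iter_transition => k; rewrite add0n; case: eqP => // ->.
by rewrite (negbTE gn).
Qed.

(* The law is constant on the set of words of a given type, which has
   [nb_type g] elements. *)
Lemma convolution_pow_nb_type n g : law n g * nb_type R g <= 1.
Proof.
pose r := word_sphere G1 G2 (size g) (head_side g).
have -> : law n g * nb_type R g = \sum_(k <- r) law n k * 1.
  rewrite /nb_type -size_word_sphere -/r mulr_natr.
  rewrite (eq_big_seq (fun=> law n g)) ?big_const_seq ?count_predT ?iter_addr_0 // => k.
  rewrite mem_word_sphere mulr1 => /andP[/eqP sk ik]; rewrite convolution_pow_transition.
  pose phi (i : bool) (k : nat) : R := (k == 0%N)%:R.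
  have -> : (fun g : G => (g == 1%g)%:R) = type_fun phi.
    apply/funext => h; congr (_%:R); rewrite /phi /type_fun.
    by rewrite -(inj_eq val_inj) /=; case: (fp_word h).
  rewrite !iter_transition_type // /type_fun sk.
  case: (size g) ik => [_|m /= /eqP -> //].
  by case: head_side; case: head_side; rewrite // iter_type_transition0.
rewrite convolution_pow_sum ?uniq_word_sphere //.
rewrite -[leRHS](iter_transition_cst cardG1 cardG2 p n 1 1%g).
by apply: ler_iter_transition => // k; case: ifP.
Qed.

End Convolution.

(** * Volume and entropy, both up to a logarithmic error *)

Lemma cvg_mean_log_error (R : realType) (u : nat -> R) (a C : R) :
  (forall n, `|u n - a * n%:R| <= C + ln n.*2.+1%:R) ->
  n%:R^-1 * u n @[n --> \oo] --> a.
Proof.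
move=> uE; apply/cvgrPdist_le => e e0.
(* For small [t], [ln y = ln (t * y) - ln t <= t * y - ln t]. *)
pose t := e / 4; have t0 : 0 < t by rewrite divr_gt0.
(* The error is then at most [2 * t * n + B]; once [B <= t * n] it is below [4 * t * n = e * n]. *)
pose B := C + t - ln t.
exists (Num.truncn (`|B| / t)).+1 => // n /= Bn.
have n0 : 0 < n%:R :> R by rewrite ltr0n; exact: leq_trans Bn.
have B_le : B <= n%:R * t.
  apply: (le_trans (ler_norm _)); rewrite -ler_pdivrMr // ltW //.
  by apply: lt_le_trans (truncnS_gt _) _; rewrite ler_nat.
have y0 : 0 < n.*2.+1%:R :> R by rewrite ltr0n.
have := uE n; have := ln_sublinear (mulr_gt0 t0 y0).
rewrite lnM ?posrE // => ln_lt u_le.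
have -> : a - n%:R^-1 * u n = (a * n%:R - u n) / n%:R.
  by rewrite mulrBl mulfK ?gt_eqF // [u n / _]mulrC.
rewrite distrC in u_le.
rewrite normrM normfV [X in _ / X]ger0_norm ?(ltW n0) // ler_pdivrMr //.
apply: (le_trans u_le).
have y_eq : n.*2.+1%:R = 2 * n%:R + 1 :> R by rewrite -natr1 -muln2 natrM mulrC.
have e_eq : e = 4 * t by rewrite /t; field.
move: ln_lt B_le (mulr_gt0 t0 n0); rewrite e_eq /B y_eq => ? ? ?; lra.
Qed.

Section EntropyVolume.
Variables (R : realType) (G1 G2 : finGroupType).
Hypotheses (cardG1 : (1 < #|G1|)%N) (cardG2 : (1 < #|G2|)%N).
Hypothesis cardG12 : ~ (#|G1| = 2%N /\ #|G2| = 2%N).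
Local Notation G := (free_prod G1 G2).
Local Notation c := (nbR R G1 G2).
Implicit Types (g : G) (n k : nat) (i : bool).

Definition volume : R := ln (c true * c false) / 2.

Lemma volume_gt0 : 0 < volume.
Proof.
rewrite divr_gt0 // ln_gt0 //.
by apply: lt_le_trans (nbR_prod_ge2 R cardG1 cardG2 cardG12); rewrite ltr1n.
Qed.

(** In a word of odd length the side of the first letter occurs once more than the other; this is
    the resulting excess in the logarithm of the count. *)
Definition parity_defect i : R := ln (c i) - volume.

Lemma parity_defectN i : parity_defect (~~ i) = - parity_defect i.
Proof.
have c0 s : c s \is Num.pos by rewrite posrE nbR_gt0.
by rewrite /parity_defect /volume lnM ?c0 //; case: i => /=; field.
Qed.

Lemma ln_nb_words k i : ln (nb_words G1 G2 k i)%:R =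
  volume * k%:R + (odd k)%:R * parity_defect i.
Proof.
elim: k i => [|k IH] i; first by rewrite /= ln1 mulr0 mul0r addr0.
rewrite /= natrM lnM ?posrE ?ltr0n ?nb_letters_gt0 ?nb_words_gt0 // IH parity_defectN.
rewrite -[ln _%:R]/(ln (c i)) -natr1 -[ln (c i)](subrK volume) -/(parity_defect i).
by case: (odd k) => /=; ring.
Qed.

Definition ln_type_error : R := `|parity_defect true| + `|parity_defect false|.

Lemma ln_nb_words_near k i :
  `|ln (nb_words G1 G2 k i)%:R - volume * k%:R| <= ln_type_error.
Proof.
rewrite ln_nb_words addrAC subrr add0r /ln_type_error.
case: (odd k); rewrite ?mul1r ?mul0r ?normr0 ?addr_ge0 //.
by case: i; rewrite ?lerDl ?lerDr.
Qed.

(** A single type of length [n] bounds the ball from below. From above, there are [2n+1] types, each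
    of at most [expR (volume * n + ln_type_error)] elements. *)
Lemma volumeP : is_volume (Sigma G1 G2) volume.
Proof.
apply: (@cvg_mean_log_error _ _ _ ln_type_error) => n.
have -> : #|` fset_set [set g | (word_length (Sigma G1 G2) g <= n)%N]| =
    size (word_ball G1 G2 n).
  have -> : [set g | (word_length (Sigma G1 G2) g <= n)%N] =
      [set` [fset g in word_ball G1 G2 n]%fset].
    by apply/seteqP; split=> g /=; rewrite word_length_Sigma !inE mem_word_ball.
  by rewrite set_fsetK card_fseq undup_id ?uniq_word_ball.
set N := size _.
have sphere_le : (nb_words G1 G2 n true <= N)%N.
  rewrite -size_word_sphere uniq_leq_size ?uniq_word_sphere // => g.
  by rewrite mem_word_sphere mem_word_ball => /andP[/eqP->].
have N0 : 0 < N%:R :> R by rewrite ltr0n (leq_trans _ sphere_le) ?nb_words_gt0.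
have y0 : 0 < n.*2.+1%:R :> R by rewrite ltr0n.
have N_le : N%:R <= n.*2.+1%:R * expR (volume * n%:R + ln_type_error).
  rewrite -(sum_word_ball_nb_typeV cardG1 cardG2) mulr_suml.
  have -> : N%:R = \sum_(g <- word_ball G1 G2 n) 1 :> R.
    by rewrite big_const_seq count_predT iter_addr_0.
  rewrite big_seq [leRHS]big_seq; apply: ler_sum => g; rewrite mem_word_ball => gn.
  rewrite mulrC ler_pdivlMr ?nb_type_gt0 // mul1r -[leLHS]lnK ?posrE ?nb_type_gt0 //.
  rewrite ler_expR.
  have := ln_nb_words_near (size g) (head_side g); rewrite -/(nb_type R g).
  have : volume * (size g)%:R <= volume * n%:R.
    by rewrite ler_wpM2l ?ler_nat // ltW // volume_gt0.
  rewrite ler_norml => ? /andP[? ?]; lra.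
have := ln_nb_words_near n true.
have : ln (nb_words G1 G2 n true)%:R <= ln (N%:R) :> R.
  by rewrite ler_ln ?posrE ?ltr0n ?nb_words_gt0 // ?ler_nat // -(ltr0n R).
have : ln N%:R <= ln n.*2.+1%:R + (volume * n%:R + ln_type_error) :> R.
  rewrite -[volume * _ + _]expRK -lnM ?posrE ?expR_gt0 // ler_ln ?posrE //.
  by rewrite mulr_gt0 ?expR_gt0.
have : 0 <= ln n.*2.+1%:R :> R by rewrite ln_ge0 // ler1n.
rewrite !ler_norml => ? ? ? /andP[? ?]; apply/andP; split; lra.
Qed.

Variable p : R.
Hypothesis p01 : 0 < p < 1.
Local Notation law := (convolution_pow (mu_p G1 G2 p)).
Local Notation gamma := (speed G1 G2 p).
Local Notation f := (type_fun (potential G1 G2 p) : G -> R).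

(** The mean of the potential is exactly [gamma * n], and the length is within [C] of it
    pointwise. *)
Lemma mean_size : exists2 C : R, 0 <= C & forall n,
  `|\sum_(g <- word_ball G1 G2 n) law n g * (size g)%:R - gamma * n%:R| <= C.
Proof.
have [C C0 fC] := potential_bounded cardG1 cardG2 cardG12 p01.
exists C => // n; rewrite -(iter_transition_potential cardG1 cardG2 p01).
rewrite -(convolution_pow_word_ball cardG1 cardG2) -sumrB.
apply: le_trans (ler_norm_sum _ _ _) _.
rewrite -[leRHS](iter_transition_cst cardG1 cardG2 p n C 1%g).
rewrite -convolution_pow_word_ball //; apply: ler_sum => g _.
rewrite -mulrBr normrM ger0_norm ?convolution_pow_ge0 //.
by rewrite ler_wpM2l ?convolution_pow_ge0 // distrC; exact: fC.
Qed.

Lemma sum_law n : \sum_(g <- word_ball G1 G2 n) law n g = 1.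
Proof.
under eq_bigr do rewrite -[law n _]mulr1.
by rewrite convolution_pow_word_ball // iter_transition_cst.
Qed.

Lemma mean_ln_nb_type : exists C : R, forall n,
  `|\sum_(g <- word_ball G1 G2 n) law n g * ln (nb_type R g)
     - gamma * volume * n%:R| <= C.
Proof.
have [C C0 sizeC] := mean_size; exists (ln_type_error + volume * C) => n.
have /(ler_wpM2l (ltW volume_gt0)) := sizeC n.
rewrite -{1}[volume]gtr0_norm ?volume_gt0 // -normrM mulrBr mulr_sumr.
set A := \sum_(g <- _) _ => A_le.
have B_le : `|\sum_(g <- word_ball G1 G2 n) law n g * ln (nb_type R g) - A|
    <= ln_type_error.
  rewrite /A -sumrB; apply: le_trans (ler_norm_sum _ _ _) _.
  rewrite -[leRHS]mul1r -[X in _ <= X * _](sum_law n) mulr_suml; apply: ler_sum => g _.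
  rewrite mulrCA -mulrBr normrM ger0_norm ?convolution_pow_ge0 //.
  by rewrite ler_wpM2l ?convolution_pow_ge0 //; exact: ln_nb_words_near.
move: A_le B_le; rewrite !ler_norml mulrA [volume * gamma]mulrC.
by move=> /andP[? ?] /andP[? ?]; apply/andP; split; lra.
Qed.

(* Lower bound: the law is at most [1 / nb_type]; upper bound: Gibbs' inequality
   against the subprobability [1 / ((2n+1) nb_type)] on the ball. *)
Lemma entropy_bounds n :
  \sum_(g <- word_ball G1 G2 n) law n g * ln (nb_type R g)
    <= - \sum_(g <- word_ball G1 G2 n) law n g * ln (law n g)
    <= \sum_(g <- word_ball G1 G2 n) law n g * ln (nb_type R g) + ln n.*2.+1%:R.
Proof.
set M := \sum_(g <- _) _ * ln (nb_type _ _); set K : R := n.*2.+1%:R.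
have K0 : 0 < K by rewrite ltr0n.
apply/andP; split.
  rewrite -sumrN; apply: ler_sum => g _.
  have := convolution_pow_ge0 cardG1 cardG2 p01 n g; rewrite le_eqVlt => /predU1P[<-|m0].
    by rewrite !mul0r oppr0.
  have N0 := nb_type_gt0 cardG1 cardG2 R g.
  rewrite -mulrN ler_wpM2l ?(ltW m0) // -lnV ?posrE // ler_ln ?posrE ?invr_gt0 //.
  by rewrite -[leRHS]mul1r ler_pdivlMr // mulrC convolution_pow_nb_type.
(* The added differences sum to 0, as the reference weights and the law both have mass 1 on the
   ball; the inequality can then be proved term by term. *)
have -> : M + ln K = \sum_(g <- word_ball G1 G2 n)
    (law n g * (ln (nb_type R g) + ln K) + ((nb_type R g)^-1 / K - law n g)).
  rewrite big_split /= sumrB -mulr_suml sum_word_ball_nb_typeV // sum_law.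
  rewrite divff ?gt_eqF // subrr addr0.
  under [RHS]eq_bigr do rewrite mulrDr.
  by rewrite big_split /= -mulr_suml sum_law mul1r.
rewrite -sumrN; apply: ler_sum => g _.
have N0 := nb_type_gt0 cardG1 cardG2 R g.
have := convolution_pow_ge0 cardG1 cardG2 p01 n g; rewrite le_eqVlt => /predU1P[<-|m0].
  by rewrite !mul0r oppr0 add0r addr0 divr_ge0 ?invr_ge0 ?ltW.
set m := law n g in m0 *; set N := nb_type R g in N0 *.
(* The inequality [ln y <= y - 1] at the ratio [y] of the reference weight to the law. *)
have : ln (m * N * K)^-1 <= (m * N * K)^-1 - 1.
  by have := @le_ln1Dx R ((m * N * K)^-1 - 1); rewrite addrCA subrr addr0; apply;
    rewrite ltrBrDl subrr invr_gt0 !mulr_gt0.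
rewrite lnV ?posrE ?mulr_gt0 // !lnM ?posrE ?mulr_gt0 // => /(ler_wpM2l (ltW m0)).
have -> : m * ((m * N * K)^-1 - 1) = N^-1 / K - m by field; rewrite !gt_eqF.
rewrite mulrN !mulrDr; move: (m * ln m) (m * ln N) (m * ln K) (N^-1 / K - m) => *; lra.
Qed.

Lemma entropyP : is_entropy (mu_p G1 G2 p) (gamma * volume).
Proof.
have [C MC] := mean_ln_nb_type.
rewrite /is_entropy; under eq_fun do rewrite -mulrN.
apply: (@cvg_mean_log_error _ _ _ C) => n.
rewrite (fsbig_setT_seq (r := word_ball G1 G2 n)) ?uniq_word_ball //; last first.
  by move=> g gn; rewrite convolution_pow_out // mul0r.
have /= := entropy_bounds n; have := MC n.
have : 0 <= ln n.*2.+1%:R :> R by rewrite ln_ge0 // ler1n.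
rewrite !ler_norml => ? /andP[? ?] /andP[? ?]; apply/andP; split; lra.
Qed.

End EntropyVolume.

Theorem mainTheorem7 (R : realType) (G1 G2 : finGroupType)
  (hG1 : (1 < #|G1|)%N) (hG2 : (1 < #|G2|)%N)
  (hG : ~ (#|G1| = 2%N /\ #|G2| = 2%N))
  (p : R) (hp : 0 < p < 1)
  (d : measure_display) (Omega : measurableType d) (P : probability Omega R)
  (x : nat -> Omega -> free_prod G1 G2) (hx : iid_of_law P x (mu_p G1 G2 p)) :
  exists h gamma v : R,
    [/\ is_entropy (mu_p G1 G2 p) h,
        is_drift P (Sigma G1 G2) x gamma,
        is_volume (Sigma G1 G2) v
      & h / (gamma * v) = 1].
Proof.
exists (speed G1 G2 p * volume R G1 G2), (speed G1 G2 p), (volume R G1 G2); split.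
- exact: entropyP.
- exact: drift_speed.
- exact: volumeP.
- by rewrite divff // gt_eqF // mulr_gt0 ?speed_gt0 ?volume_gt0.
Qed.
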